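(* Let $n\geq 2$ be an integer, let $L_{2,n}=L_2\times L_n$ be the product of a $2$-element chain and an $n$-element chain, let $k$ be a field, $S_n=k[y_1,\ldots,y_{3n-2}]$ and $T_n=k[x_1,\ldots,x_{2n}]$, with $I_{\mathrm{LD}}(L_{2,n})\subseteq S_n$ and $I_{n+1}(L_{2,n})\subseteq T_n$. Then: (i) $\operatorname{pd}(S_n/I_{\mathrm{LD}}(L_{2,n}))=n$ and $\operatorname{pd}(T_n/I_{n+1}(L_{2,n}))=2$; (ii) $\operatorname{reg}(S_n/I_{\mathrm{LD}}(L_{2,n}))=2n-2$ and $\operatorname{reg}(T_n/I_{n+1}(L_{2,n}))=n$; (iii) $\operatorname{depth}(S_n/I_{\mathrm{LD}}(L_{2,n}))=2n-2$ and $\operatorname{depth}(T_n/I_{n+1}(L_{2,n}))=2n-2$.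
   Context: $L_{2,n}$ has elements $(i,s)$ with $i\in\{0,1\}$, $0\leq s\leq n-1$, ordered by $(i,s)\leq (j,t)$ iff $i\leq j$ and $s\leq t$. Its $2n$ elements are identified with $x_1,\ldots,x_{2n}$ and its $3n-2$ cover relations (edges of the Hasse diagram) with $y_1,\ldots,y_{3n-2}$. $I_{\mathrm{LD}}(L_{2,n})\subseteq S_n$ is the ideal generated by the monomials $\prod_{e\in\pi}y_e$, where $\pi$ runs over the maximal saturated chains of $L_{2,n}$ and the product is over the cover relations (edges) of $\pi$. $I_{n+1}(L_{2,n})\subseteq T_n$ is the path ideal generated by the monomials $\prod_{v\in\pi}x_v$, where $\pi$ runs over the saturated chains with $n+1$ elements (these are the maximal chains) and the product is over the elements of $\pi$. $\operatorname{pd}$, $\operatorname{reg}$ and $\operatorname{depth}$ are projective dimension, Castelnuovo–Mumford regularity and depth (with respect to the graded maximal ideal). *)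

(* Defs.v *)
From HB Require Import structures.
From mathcomp Require Import all_boot all_order all_algebra.
From mathcomp Require Import boolp.
From mathcomp Require Import mpoly zify.

Set Implicit Arguments.
Unset Strict Implicit.
Unset Printing Implicit Defensive.

Import Order.TTheory GRing.Theory.

Local Open Scope ring_scope.
Local Open Scope quotient_scope.

Section QuotientModule.
Variables (R : pzRingType) (V : lmodType R) (U : submodClosed V).

(* A copy of U which also carries the zmodClosed structure that             *)
(* ring_quotient requires and submodClosed does not provide.                *)
Definition submod_pred : {pred V} := fun v => v \in U.

Lemma submod_pred_zmod_closed : zmod_closed submod_pred.
Proof. exact: GRing.submod_closedB (submodClosedP U). Qed.

HB.instance Definition _ := GRing.isZmodClosed.Build V submod_pred
  submod_pred_zmod_closed.

Definition quotmod : Type := Quotient.quot submod_pred.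

HB.instance Definition _ := GRing.Zmodule.on quotmod.

Definition proj_quotmod (v : V) : quotmod := \pi_(Quotient.quot submod_pred) v.

Definition scale_quotmod (a : R) (x : quotmod) : quotmod :=
  proj_quotmod (a *: (repr (x : Quotient.quot submod_pred) : V)).

Lemma proj_quotmod_eq (u v : V) : proj_quotmod u = proj_quotmod v <-> u - v \in U.
Proof.
have -> : (u - v \in U) = (proj_quotmod u == proj_quotmod v).
  exact: (Quotient.idealrBE submod_pred).
by split=> [/eqP | /eqP].
Qed.

Lemma repr_quotmodK (x : quotmod) : proj_quotmod (repr (x : Quotient.quot submod_pred)) = x.
Proof. exact: reprK. Qed.

Lemma proj_quotmodD (u v : V) :
  proj_quotmod (u + v) = proj_quotmod u + proj_quotmod v.
Proof. exact: (raddfD (\pi_(Quotient.quot submod_pred))). Qed.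

Lemma proj_quotmodZ (a : R) (v : V) :
  proj_quotmod (a *: v) = scale_quotmod a (proj_quotmod v).
Proof.
apply/proj_quotmod_eq; rewrite -scalerBr rpredZ //.
by apply/proj_quotmod_eq; rewrite repr_quotmodK.
Qed.

Lemma scale_quotmodA a b x :
  scale_quotmod a (scale_quotmod b x) = scale_quotmod (a * b) x.
Proof. by rewrite -(repr_quotmodK x) -!proj_quotmodZ scalerA. Qed.

Lemma scale1_quotmod : left_id 1 scale_quotmod.
Proof. by move=> x; rewrite -(repr_quotmodK x) -!proj_quotmodZ scale1r. Qed.

Lemma scale_quotmodDr : right_distributive scale_quotmod +%R.
Proof.
move=> a x y; rewrite -(repr_quotmodK x) -(repr_quotmodK y).
by rewrite -proj_quotmodD -!proj_quotmodZ -proj_quotmodD scalerDr.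
Qed.

Lemma scale_quotmodDl v : {morph scale_quotmod^~ v : a b / a + b}.
Proof.
move=> a b; rewrite -(repr_quotmodK v) -!proj_quotmodZ.
by rewrite -proj_quotmodD scalerDl.
Qed.

HB.instance Definition _ := GRing.Zmodule_isLmodule.Build R quotmod
  scale_quotmodA scale1_quotmod scale_quotmodDr scale_quotmodDl.

Lemma proj_quotmod_is_linear : linear proj_quotmod.
Proof. by move=> a u v; rewrite proj_quotmodD proj_quotmodZ. Qed.

HB.instance Definition _ :=
  GRing.isLinear.Build R V quotmod _ proj_quotmod proj_quotmod_is_linear.

End QuotientModule.

Section GeneratedIdeal.
Variables (R : comNzRingType) (G : R -> Prop).

Definition ideal_gen (p : R) : Prop :=
  exists m (c g : 'I_m -> R), (forall i, G (g i)) /\ p = \sum_(i < m) c i * g i.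

Definition ideal_pred : {pred R^o} := fun p : R => `[< ideal_gen p >].

Lemma ideal_gen0 : ideal_gen 0.
Proof.
exists 0, (fun=> 0), (fun=> 0); split; first by case.
by rewrite big_ord0.
Qed.

Lemma ideal_gen_lin (a p q : R) :
  ideal_gen p -> ideal_gen q -> ideal_gen (a * p + q).
Proof.
move=> [m [c [g [Gg ->]]]] [m' [c' [g' [Gg' ->]]]].
exists (m + m')%N,
  (fun i => match split i with inl j => a * c j | inr j => c' j end),
  (fun i => match split i with inl j => g j | inr j => g' j end).
split; first by move=> i; case: (split i).
rewrite big_split_ord /= mulr_sumr; congr (_ + _); apply: eq_bigr => i _.
  by rewrite (unsplitK (inl i)) mulrA.
by rewrite (unsplitK (inr i)).
Qed.

Lemma ideal_pred_closed : submod_closed ideal_pred.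
Proof.
split; first by apply/asboolP; exact: ideal_gen0.
by move=> a u v /asboolP up /asboolP vp; apply/asboolP; exact: ideal_gen_lin.
Qed.

HB.instance Definition _ :=
  GRing.isSubmodClosed.Build R R^o ideal_pred ideal_pred_closed.

(* The cyclic module R / (G). *)
Definition quot_ideal : lmodType R := quotmod ideal_pred.

Definition quot_ideal_pi (p : R) : quot_ideal := proj_quotmod ideal_pred (p : R^o).

End GeneratedIdeal.

Section ProjectiveDimension.
Variable R : nzRingType.

Definition projective (P : lmodType R) : Prop :=
  forall (A B : lmodType R) (g : {linear A -> B}) (f : {linear P -> B}),
    (forall b, exists a, g a = b) ->
    exists h : {linear P -> A}, forall x, g (h x) = f x.

Record proj_resolution (M : lmodType R) := ProjResolution {
  pres_mod :> nat -> lmodType R;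
  pres_dif : forall i, {linear pres_mod i.+1 -> pres_mod i};
  pres_aug : {linear pres_mod 0 -> M};
  _ : forall i, projective (pres_mod i);
  _ : forall y, exists x, pres_aug x = y;
  _ : forall x, pres_aug x = 0 <-> exists z, x = pres_dif 0 z;
  _ : forall i x, pres_dif i x = 0 <-> exists z, x = pres_dif i.+1 z
}.

Definition pd_le (M : lmodType R) (d : nat) : Prop :=
  exists P : proj_resolution M, forall i, (d < i)%N -> forall x : P i, x = 0.

Definition is_pd (M : lmodType R) (d : nat) : Prop :=
  pd_le M d /\ forall e, pd_le M e -> (d <= e)%N.

End ProjectiveDimension.

Section Depth.
Variables (R : comNzRingType) (M : lmodType R).

(* x lies in the submodule (f_0, f_1, ...) M. *)
Definition in_seq_mul (f : seq R) (x : M) : Prop :=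
  exists m : nat -> M, x = \sum_(j < size f) f`_j *: m j.

Definition regular_seq (f : seq R) : Prop :=
  (forall i, (i < size f)%N -> forall x : M,
     in_seq_mul (take i f) (f`_i *: x) -> in_seq_mul (take i f) x) /\
  exists x : M, ~ in_seq_mul f x.

Definition is_depth (m : R -> Prop) (d : nat) : Prop :=
  (exists f, [/\ size f = d, {in f, forall a, m a} & regular_seq f]) /\
  forall f, {in f, forall a, m a} -> regular_seq f -> (size f <= d)%N.

End Depth.

Definition max_ideal (k : fieldType) (N : nat) : {mpoly k[N]} -> Prop :=
  ideal_gen (fun p : {mpoly k[N]} => exists i, p = 'X_i).

Section Regularity.
Variables (k : fieldType) (N : nat).
Local Notation S := {mpoly k[N]}.

(* A minimal graded free resolution of a module M with graded pieces gr d.  *)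
(* The i-th free module has a basis of rk i elements, the r-th one being of *)
(* degree deg r; maps act on row vectors from the right.                    *)
Record min_graded_resolution (M : lmodType S) (gr : nat -> M -> Prop) :=
MinGradedResolution {
  rk : nat -> nat;
  deg : forall i, 'I_(rk i) -> nat;
  dif : forall i, 'M[S]_(rk i.+1, rk i);
  aug : {linear 'rV[S]_(rk 0) -> M};
  _ : forall c, gr (deg c) (aug (delta_mx 0 c));
  _ : forall i (r : 'I_(rk i.+1)) (c : 'I_(rk i)),
        ((deg c <= deg r)%N -> dif i r c \is (deg r - deg c)%N.-homog) /\
        ((deg r < deg c)%N -> dif i r c = 0);
  _ : forall y, exists v, aug v = y;
  _ : forall v, aug v = 0 <-> exists w, v = w *m dif 0;
  _ : forall i (v : 'rV[S]_(rk i.+1)),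
        v *m dif i = 0 <-> exists w, v = w *m dif i.+1;
  _ : forall i r c, max_ideal (dif i r c)
}.

Definition betti (M : lmodType S) (gr : nat -> M -> Prop)
    (F : min_graded_resolution gr) (i j : nat) : nat :=
  #|[set r : 'I_(rk F i) | deg r == j]|.

(* r is the maximum of the j - i such that betti i j <> 0. It is not        *)
(* negative since the generators of M have degree at least 0.               *)
Definition is_reg (M : lmodType S) (gr : nat -> M -> Prop) (r : nat) : Prop :=
  exists F : min_graded_resolution gr,
    (forall i j, betti F i j <> 0%N -> (j <= i + r)%N) /\
    (exists i j, betti F i j <> 0%N /\ j = (i + r)%N).

Definition quot_gr (G : S -> Prop) (d : nat) (x : quot_ideal G) : Prop :=
  exists p : S, p \is d.-homog /\ x = quot_ideal_pi G p.

End Regularity.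

Section Chains.
Context {disp : Order.disp_t} (L : finPOrderType disp).

Definition covered : rel L :=
  fun u v => (u < v)%O && [forall w : L, ~~ ((u < w)%O && (w < v)%O)].

Definition edge : finType := {e : L * L | covered e.1 e.2}.

Definition saturated (s : seq L) : bool := sorted covered s.

Definition max_saturated (s : seq L) : Prop :=
  saturated s /\
  forall s', saturated s' -> {subset s <= s'} -> {subset s' <= s}.

Definition chain_edge (s : seq L) (e : edge) : bool :=
  val e \in zip s (behead s).

Definition LD_gen (k : fieldType) (N : nat) (y : edge -> 'I_N)
    (p : {mpoly k[N]}) : Prop :=
  exists s, max_saturated s /\ p = \prod_(e : edge | chain_edge s e) 'X_(y e).

Definition path_gen (k : fieldType) (t N : nat) (x : L -> 'I_N)
    (p : {mpoly k[N]}) : Prop :=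
  exists s, [/\ saturated s, size s = t & p = \prod_(v <- s) 'X_(x v)].

End Chains.

Arguments edge {disp} L.

Definition L2 (n : nat) : finPOrderType _ := ('I_2 *p 'I_n)%type.

Lemma lt_L2 n (u v : L2 n) :
  (u < v)%O =
    [&& (u.1 <= v.1)%N, (u.2 <= v.2)%N & (u.1 < v.1)%N || (u.2 < v.2)%N].
Proof.
case: u v => [i s] [j t]; rewrite Order.ProdOrder.ltEprod /=.
by rewrite -pair_eqE /= -!(inj_eq val_inj) /= !leEord; lia.
Qed.

Lemma covered_L2 n (u v : L2 n) :
  covered u v =
    ((u.1 == v.1 :> nat) && (v.2 == u.2.+1 :> nat))
    || [&& u.1 == 0 :> nat, v.1 == 1 :> nat & u.2 == v.2 :> nat].
Proof.
case: u v => [i s] [j t]; rewrite /covered lt_L2 /=.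
have [[[li lj] ls] lt] := (ltn_ord i, ltn_ord j, ltn_ord s, ltn_ord t).
apply/andP/idP => [[uv /forallP nw] | h].
  have := nw (i, t); have := nw (j, s); rewrite !lt_L2 /=.
  case: (ltnP s.+1 t) => [st | ]; last by lia.
  have := nw (i, Ordinal (ltn_trans st lt)); rewrite !lt_L2 /=; lia.
split; first by lia.
by apply/forallP => -[a b]; rewrite !lt_L2 /=; lia.
Qed.

Lemma card_L2 n : #|L2 n| = (2 * n)%N.
Proof. by rewrite card_prod !card_ord. Qed.

Lemma card_edge_L2 n : #|edge (L2 n)| = (3 * n - 2)%N.
Proof.
case: n => [|m].
  by apply: eq_card0 => e; case: (val e) => -[_ []].
pose f (z : 'I_2 * 'I_m + 'I_m.+1) : L2 m.+1 * L2 m.+1 :=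
  match z with
  | inl (i, s) => ((i, widen_ord (leqnSn m) s), (i, lift ord0 s))
  | inr s => ((ord0, s), (ord_max, s))
  end.
have f_inj : injective f.
  move=> z1 z2 e.
  have e1 : (f z1).1.1 = (f z2).1.1 :> nat by rewrite e.
  have e2 : (f z1).1.2 = (f z2).1.2 :> nat by rewrite e.
  have e3 : (f z1).2.1 = (f z2).2.1 :> nat by rewrite e.
  case: z1 z2 {e} e1 e2 e3 => [[i s]|s] [[j t]|t] /=; try lia.
    by move=> /val_inj -> /val_inj -> _.
  by move=> _ /val_inj ->.
rewrite card_sig (@eq_card _ _ (mem (f @: [set: 'I_2 * 'I_m + 'I_m.+1]))); last first.
  move=> [[i s] [j t]]; rewrite unfold_in /= covered_L2 /=.
  have [[[li lj] ls] lt] := (ltn_ord i, ltn_ord j, ltn_ord s, ltn_ord t).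
  apply/idP/imsetP => [h | [[[a b]|b] _ /=]]; last 2 first.
  - by case=> -> -> -> ->; rewrite /= /bump; lia.
  - by case=> -> -> -> ->; rewrite /=; lia.
  case/orP: h => [/andP[/eqP ij /eqP ts] | /and3P[/eqP i0 /eqP j1 /eqP st]].
    have sm : (s < m)%N by lia.
    exists (inl (i, Ordinal sm)); rewrite ?inE //=.
    by congr ((_, _), (_, _)); apply: val_inj => /=; rewrite /bump //; lia.
  exists (inr s); rewrite ?inE //=.
  by congr ((_, _), (_, _)); apply: val_inj => /=; lia.
by rewrite card_imset // cardsT card_sum card_prod !card_ord; lia.
Qed.

(* The labellings of elements and edges quantified over in the statement do exist. *)
Lemma labels_L2 n :
  (exists x : L2 n -> 'I_(2 * n), bijective x) /\
  (exists y : edge (L2 n) -> 'I_(3 * n - 2), bijective y).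
Proof.
split.
  exists (fun v => cast_ord (card_L2 n) (enum_rank v)).
  by apply: bij_comp (enum_rank_bij _); exists (cast_ord (esym (card_L2 n))) => i;
     rewrite ?cast_ordK ?cast_ordKV.
exists (fun e => cast_ord (card_edge_L2 n) (enum_rank e)).
by apply: bij_comp (enum_rank_bij _); exists (cast_ord (esym (card_edge_L2 n))) => i;
   rewrite ?cast_ordK ?cast_ordKV.
Qed.

(* Main.v *)
(* Both ideals are generated by n monomials, one for each maximal chain, indexed by the     *)
(* place t where the chain leaves the bottom row.                                          *)
(*                                                                                         *)
(* Every generator of I_LD has a private variable (its vertical edge), so the Taylor       *)
(* resolution is minimal; its length is n and the lcms of the generators give the          *)
(* regularity.  For the path ideal the syzygies between consecutive generators generate    *)
(* all syzygies, which gives a minimal resolution 0 -> T^(n-1) -> T^n -> T.  Comparing a   *)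
(* minimal resolution with an arbitrary projective one modulo the maximal ideal shows that *)
(* its length is the projective dimension.                                                 *)
(*                                                                                         *)
(* Depth, lower bound: identifying variables one at a time, X_z with X_(sigma z), is a     *)
(* regular sequence as long as lcms of pairs of generators are preserved, because then     *)
(* every syzygy after the identification lifts.                                            *)
(*                                                                                         *)
(* Depth, upper bound: if a monomial w outside I is killed by the variables in C, then     *)
(* more than N - #C elements of the maximal ideal satisfy a polynomial relation modulo     *)
(* the variables in C, and this relation kills w.  A regular sequence f admits no such     *)
(* relation unless w lies in I + (f); replacing f by high powers of its elements excludes  *)
(* that.                                                                                   *)

Require Import Defs.
From HB Require Import structures.
From mathcomp Require Import all_boot all_order all_algebra.
From mathcomp Require Import boolp.
From mathcomp Require Import mpoly zify ring.

Set Implicit Arguments.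
Unset Strict Implicit.
Unset Printing Implicit Defensive.

Import Order.TTheory GRing.Theory.

Local Open Scope ring_scope.

(** * Weakly regular sequences *)

(** A maximal chain is determined by the position t at which it leaves the bottom row
    ([max_saturatedP], [saturated_chain]), so each ideal has n monomial generators m_t and the
    invariants are governed by their lcms.

    For I_LD, the vertical edge of chain t divides m_t alone. Adding a generator therefore enlarges
    every lcm, the Taylor resolution is minimal and pd is n ([taylor_pd]). A face A has degree #|A|
    plus the number of horizontal edges on its chains; the first and last chains together contain
    all 2n-2 of them, which gives reg ([mdeg_LD_lcm], [taylor_reg]). For the path ideal, m_j divides
    lcm(m_s, m_t) when s <= j <= t, so the n-1 syzygies between neighbours generate all syzygies
    ([nbr_gen_exact]) and are independent ([nbr_mx_inj]). Generators of degree n+1 and syzygies of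
    degree n+2 give pd 2 and reg n. [min_resolution_pd] passes from a minimal free resolution to
    arbitrary projective ones.

    Depth is bounded on both sides independently of pd. From below, [regular_seq_exists] retracts
    the variables onto 2 elements (path ideal) or onto the n vertical edges (I_LD), and the
    differences X_z - X_(sigma z) over the 2n-2 moved variables form a regular sequence. From above,
    [regular_seq_size] takes a set C of variables, again of size 2 or n, that meets every generator
    in exactly one variable: the product of the other variables lies outside the ideal but is killed
    by C, which bounds the depth by the number 2n-2 of variables outside C. *)

Section WeaklyRegular.
Variable R : comNzRingType.
Implicit Types (U : R -> Prop) (f : seq R).
Definition ideal_adj U (a : R) : R -> Prop := fun x => exists y, U (x - a * y).

Definition is_ideal U :=
  [/\ U 0, forall x y, U x -> U y -> U (x + y) & forall a x, U x -> U (a * x)].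

(** Regularity on R/U without the condition that the final quotient be nonzero, so that it passes
    through exact sequences. *)
Fixpoint wregular U f : Prop :=
  if f is a :: f' then
    (forall x, U (a * x) -> U x) /\ wregular (ideal_adj U a) f'
  else True.

Definition ideal_adjs U f := foldl ideal_adj U f.

Lemma is_idealB U x y : is_ideal U -> U x -> U y -> U (x - y).
Proof. by case=> _ UD UM Ux Uy; apply: UD => //; rewrite -mulN1r; apply: UM. Qed.

Lemma ideal_adj_ideal U a : is_ideal U -> is_ideal (ideal_adj U a).
Proof.
move=> [U0 UD UM]; split=> [|x y [x' Ux] [y' Uy]|b x [x' Ux]].
- by exists 0; rewrite mulr0 subr0.
- exists (x' + y'); rewrite (_ : _ - _ = (x - a * x') + (y - a * y')); first exact: UD.
  by ring.
- exists (b * x'); rewrite (_ : _ - _ = b * (x - a * x')); first exact: UM.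
  by ring.
Qed.

Lemma ideal_adjW U a x : U x -> ideal_adj U a x.
Proof. by exists 0; rewrite mulr0 subr0. Qed.

Lemma wregular_ext f U V : (forall x, U x <-> V x) -> wregular U f -> wregular V f.
Proof.
by move=> UV; have -> : U = V by apply/funext => x; apply/propext.
Qed.

(* 0 -> R/U1 --a--> R/U -> R/U2 -> 0 is exact. *)
Lemma wregular_extension f U U1 U2 a :
    is_ideal U -> is_ideal U1 -> is_ideal U2 ->
    (forall x, U1 x <-> U (a * x)) -> (forall x, U2 x <-> ideal_adj U a x) ->
  wregular U1 f -> wregular U2 f -> wregular U f.
Proof.
elim: f U U1 U2 => [//|b f IH] U U1 U2 iU iU1 iU2 e1 e2 [b1 w1] [b2 w2].
have [U0 UD UM] := iU; have UB := @is_idealB _ _ _ iU.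
split.
  move=> x Ubx; have /e2 [y Uy] : U2 x.
    by apply: b2; apply/e2; apply: ideal_adjW.
  have /e1 Uay : U1 y.
    apply: b1; apply/e1.
    rewrite (_ : a * _ = b * x - b * (x - a * y)); last by ring.
    by apply: UB => //; apply: UM.
  by rewrite -(subrK (a * y) x); apply: UD.
apply: (IH (ideal_adj U b) (ideal_adj U1 b) (ideal_adj U2 b)) => //;
  try exact: ideal_adj_ideal.
  move=> x; split=> [[y /e1 Uy]|[z Uz]].
    by exists (a * y); rewrite (_ : _ - _ = a * (x - b * y)) //; ring.
  have /e2 [y Uy] : U2 z.
    apply: b2; apply/e2; exists x.
    rewrite (_ : _ - _ = (- 1) * (a * x - b * z)); last by ring.
    exact: UM.
  exists y; apply/e1.
  rewrite (_ : a * _ = (a * x - b * z) + b * (z - a * y)); last by ring.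
  by apply: UD => //; apply: UM.
move=> x; split=> [[z /e2 [y Uy]]|[y [z Uz]]].
  exists y; exists z.
  by rewrite (_ : _ - _ = x - b * z - a * y) //; ring.
exists z; apply/e2; exists y.
by rewrite (_ : _ - _ = x - a * y - b * z) //; ring.
Qed.

(** Multiplication by a^(t+1) embeds R/(U + (a)) into R/(U + (a^(t+2))), because a is a
    nonzerodivisor modulo U, and the cokernel is R/(U + (a^(t+1))). [wregular_extension] then raises
    the exponent by one. *)
Lemma wregular_exp1 U a f t : is_ideal U ->
  wregular U (a :: f) -> wregular (ideal_adj U (a ^+ t.+1)) f.
Proof.
move=> iU [ra wf]; elim: t => [|t IH]; first by rewrite expr1.
have rat s x : U (a ^+ s * x) -> U x.
  by elim: s x => [|s IHs] x; rewrite ?mul1r // exprS -mulrA => /ra/IHs.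
apply: (@wregular_extension f _ (ideal_adj U a) (ideal_adj U (a ^+ t.+1)) (a ^+ t.+1));
  rewrite ?expr1 //; try exact: ideal_adj_ideal.
  move=> x; split=> [[y Uy]|[y Uy]]; exists y.
    rewrite [a ^+ t.+2]exprSr (_ : _ - _ = a ^+ t.+1 * (x - a * y)); last by ring.
    by case: iU => _ _ UM; apply: UM.
  by apply: (rat t.+1); rewrite mulrBr mulrA -[_ * a]exprSr.
move=> x; split=> [[y Uy]|[y [z Uz]]].
  by exists y; apply: ideal_adjW.
exists (y + a * z).
rewrite (_ : _ - _ = x - a ^+ t.+1 * y - a ^+ t.+2 * z); first exact: Uz.
by rewrite [a ^+ t.+2]exprSr; ring.
Qed.

Lemma wregular_exp U f t : is_ideal U ->
  wregular U f -> wregular U [seq a ^+ t.+1 | a <- f].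
Proof.
elim: f U => [//|a f IH] U iU waf /=; have [ra wf] := waf; split.
  elim: (t.+1) => [|s IHs] x; first by rewrite mul1r.
  by rewrite exprS -mulrA => /ra/IHs.
by apply: IH; [apply: ideal_adj_ideal | apply: wregular_exp1].
Qed.

Lemma ideal_adjsP U f x : ideal_adjs U f x <->
  exists m : nat -> R, U (x - \sum_(j < size f) f`_j * m j).
Proof.
elim: f U x => [|a f IH] U x /=.
  by split=> [Ux|[m]]; [exists (fun=> 0)|]; rewrite big_ord0 subr0.
rewrite IH; split=> [[m [y Uy]]|[m Um]].
  exists (fun j => if j is j'.+1 then m j' else y).
  by rewrite big_ord_recl /= opprD addrA addrAC.
exists (fun j => m j.+1); exists (m 0%N).
by move: Um; rewrite big_ord_recl /= opprD addrA addrAC.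
Qed.

Lemma wregularP U f : wregular U f <->
  (forall i, (i < size f)%N -> forall x,
     ideal_adjs U (take i f) (f`_i * x) -> ideal_adjs U (take i f) x).
Proof.
elim: f U => [//|a f IH] U; split=> [[ra /IH wf] [_ x|i lti x]|h] //=.
- exact: ra.
- exact: wf.
- by split; [exact: (h 0%N) | apply/IH => i lti x; exact: (h i.+1)].
Qed.

End WeaklyRegular.

(** * Independence of the monomials in a weakly regular sequence *)

Section MonomialIndependence.
Variables (k : fieldType) (A : comUnitAlgType k).
Implicit Types (U : A -> Prop) (f : seq A) (c : seq nat -> k).

Fixpoint exponents (s r : nat) : seq (seq nat) :=
  if r is r'.+1 then [seq i :: b | i <- iota 0 s, b <- exponents s r'] else [:: [::]].

Lemma size_exponents s r : size (exponents s r) = (s ^ r)%N.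
Proof. by elim: r => //= r IH; rewrite size_allpairs size_iota IH expnS. Qed.

Lemma exponents_uniq s r : uniq (exponents s r).
Proof.
elim: r => //= r IH; rewrite allpairs_uniq ?iota_uniq //.
by move=> [? ?] [? ?] _ _ /= [-> ->].
Qed.

Fixpoint power_prod f (e : seq nat) : A :=
  if f is a :: f' then a ^+ (head 0 e) * power_prod f' (behead e) else 1.

(* Induction on f: once the least power of the head a is cancelled, the relation descends *)
(* to the remaining elements modulo a.                                                   *)
Lemma wregular_independent s f U w c :
    is_ideal U -> wregular U f -> ~ ideal_adjs U f w ->
    U (\sum_(e <- exponents s (size f)) c e *: power_prod f e * w) ->
  {in exponents s (size f), forall e, c e = 0}.
Proof.
elim: f U c => [|a f IH] U c iU.
  move=> _ /= nUw; rewrite big_seq1 -scalerAl mul1r => Ucw e; rewrite inE => /eqP ->.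
  apply/eqP/negP => /negP c0; apply: nUw; have [_ _ UM] := iU.
  by have := UM ((c [::])^-1%:A) _ Ucw; rewrite -scalerAl mul1r scalerA mulVf ?scale1r.
move=> [ra wf] nUw /= Usum e /allpairsPdep [i [b [i_s b_s ->]]].
have [U0 UD UM] := iU.
pose T i := \sum_(b <- exponents s (size f)) c (i :: b) *: power_prod f b * w.
have sumE : \sum_(e0 <- [seq i :: b | i <- iota 0 s, b <- exponents s (size f)])
    c e0 *: (a ^+ head 0 e0 * power_prod f (behead e0)) * w =
    \sum_(0 <= i < s) a ^+ i * T i.
  rewrite big_allpairs_dep /index_iota subn0; apply: eq_bigr => j _.
  rewrite mulr_sumr; apply: eq_bigr => b' _ /=.
  by rewrite scalerAr -!mulrA.
rewrite {}sumE in Usum.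
elim/ltn_ind: i b i_s b_s => i IHi b i_s b_s.
have si : (i < s)%N by move: i_s; rewrite mem_iota.
have T0 j : (j < i)%N -> T j = 0.
  move=> ji; rewrite /T big_seq big1 // => b' b'_s.
  by rewrite IHi ?scale0r ?mul0r // mem_iota /=; lia.
apply: (IH (ideal_adj U a) (fun b => c (i :: b))) => //; first exact: ideal_adj_ideal.
have rai x : U (a ^+ i * x) -> U x.
  by elim: (i) x => [|j IHj] x; rewrite ?mul1r // exprS -mulrA => /ra/IHj.
rewrite -/(T i); exists (- \sum_(i.+1 <= j < s) a ^+ (j - i.+1) * T j).
apply: (rai); move: Usum; rewrite (big_cat_nat (n := i)) //=; last by lia.
rewrite [X in X + _]big_nat_cond big1 ?add0r; last first.
  by move=> j /andP[/andP[_ ji] _]; rewrite T0 // mulr0.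
rewrite big_ltn // => Usum; rewrite mulrN opprK mulrDr mulrA -exprSr.
suff -> : a ^+ i.+1 * (\sum_(i.+1 <= j < s) a ^+ (j - i.+1) * T j) =
  \sum_(i.+1 <= j < s) a ^+ j * T j by [].
rewrite mulr_sumr; apply: eq_big_nat => j /andP[ij _].
by rewrite mulrA -exprD subnKC.
Qed.
End MonomialIndependence.

(** * Algebraic dependence *)

Section AlgebraicDependence.
Variables (k : fieldType) (N : nat).
Local Notation S := {mpoly k[N]}.
Implicit Types (f : seq S) (p q : S).

Lemma msize_mul_le p q b c : (msize p <= b.+1)%N -> (msize q <= c.+1)%N ->
  (msize (p * q) <= (b + c).+1)%N.
Proof.
have [->|p0] := eqVneq p 0; first by rewrite mul0r msize0.
have [->|q0] := eqVneq q 0; first by rewrite mulr0 msize0.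
have [->|pq0] := eqVneq (p * q) 0; first by rewrite msize0.
rewrite -!mlead_deg // !ltnS => pb qc.
by have /lemc_mdeg := mleadM_le p q; rewrite mdegD; lia.
Qed.

Lemma msize_power_prod_le f b s e : {in f, forall a, msize a <= b.+1}%N ->
    e \in exponents s (size f) ->
  (msize (power_prod f e) <= (size f * (s * b)).+1)%N.
Proof.
elim: f e => [|a f IH] e fb /=; first by rewrite msize1.
case/allpairsPdep => [i [e' [i_s e's ->]]] /=; rewrite mulSn.
apply: msize_mul_le; last first.
  by apply: IH => // x xf; apply: fb; rewrite inE xf orbT.
have ab : (msize a <= b.+1)%N by apply: fb; rewrite inE eqxx.
suff ai : (msize (a ^+ i) <= (i * b).+1)%N.
  apply: leq_trans ai _; rewrite ltnS leq_mul2r.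
  by move: i_s; rewrite mem_iota; lia.
elim: (i) => [|j IHj]; first by rewrite expr0 msize1.
by rewrite exprS mulSn; apply: msize_mul_le.
Qed.

(* For r elements of degree at most b, the s ^ r coefficients exceed the                  *)
(* (s * (r * b + 1)) ^ #|D| linear constraints once s is large.                           *)
Lemma algebraic_dependence (D : pred 'I_N) f : (#|D| < size f)%N ->
  exists s, exists2 c : seq nat -> k,
    exists2 e, e \in exponents s (size f) & c e != 0 &
    forall nu : 'X_{1..N}, (forall i, ~~ D i -> nu i = 0%N) ->
      (\sum_(e <- exponents s (size f)) c e *: power_prod f e)@_nu = 0.
Proof.
move=> ltDf; set r := size f in ltDf *.
pose b := \max_(a <- f) msize a.
have fb : {in f, forall a, msize a <= b.+1}%N.
  by move=> a af; apply: leqW; rewrite /b (big_rem a) //= leq_maxl.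
(* As s exceeds (r * b + 1) ^ #|D| and r exceeds #|D|, the number (s * (r * b + 1)) ^ #|D| of
   equations is below s ^ (#|D| + 1), hence below the number s ^ r of unknowns. *)
pose s := ((r * b).+1 ^ #|D|).+1; exists s.
pose B := (s * (r * b).+1)%N; pose ex := exponents s r.
pose G : finType := {ffun {i | D i} -> 'I_B}.
pose nuG (g : G) : 'X_{1..N} :=
  [multinom (if insub i is Some i' then val (g i') else 0%N) | i < N].
pose A := \matrix_(i < size ex, j < #|G|) (power_prod f (nth [::] ex i))@_(nuG (enum_val j)).
have : kermx A != 0.
  rewrite kermx_eq0 /row_free neq_ltn (leq_ltn_trans (rank_leq_col A)) //.
  rewrite card_ffun card_ord card_sig size_exponents /B expnMn.
  rewrite -[X in (X < _)%N]/(s ^ #|D| * _)%N.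
  apply: leq_trans (_ : s ^ #|D|.+1 <= _)%N; last by rewrite leq_pexp2l.
  by rewrite expnSr ltn_pmul2l // expn_gt0.
rewrite -nz_row_eq0; set u := nz_row _ => u0.
have uA : u *m A = 0 by apply/sub_kermxP/nz_row_sub.
pose c e := if insub (index e ex) is Some i then u 0 i else 0.
have exu : uniq ex by exact: exponents_uniq.
have cE (i : 'I_(size ex)) : c (nth [::] ex i) = u 0 i.
  by rewrite /c index_uniq // valK.
exists c.
  have [i ui] : exists i, u 0 i != 0 by apply/rV0Pn.
  by exists (nth [::] ex i); rewrite ?mem_nth // cE.
move=> nu nuD.
have sumE : (\sum_(e <- ex) c e *: power_prod f e)@_nu =
    \sum_(i < size ex) u 0 i * (power_prod f (nth [::] ex i))@_nu.
  rewrite raddf_sum (big_nth [::]) big_mkord; apply: eq_bigr => i _.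
  by rewrite /= mcoeffZ cE.
(* An exponent with an entry of at least B exceeds the degree of every power product, so only the
   finitely many small ones impose a condition. *)
have [small|] := boolP [forall i, (nu i < B)%N]; last first.
  rewrite negb_forall => /existsP [i iB]; rewrite sumE big1 // => j _.
  rewrite memN_msupp_eq0 ?mulr0 //; apply/msize_mdeg_ge.
  apply: leq_trans (msize_power_prod_le fb (mem_nth [::] (ltn_ord j))) _.
  have -> : mdeg nu = (nu i + \sum_(j < N | j != i) nu j)%N by rewrite mdegE (bigD1 i).
  by move: iB; rewrite -leqNgt /B -/r; nia.
have [g gE] : exists g, nu = nuG g.
  exists [ffun i => Ordinal (forallP small (val i))].
  apply/mnmP => i; rewrite mnmE; case: insubP => [j Di ji|/nuD //].
  by rewrite ffunE /= ji.
rewrite sumE; have := congr1 (fun M : 'rV_ _ => M 0 (enum_rank g)) uA.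
rewrite !mxE => uAg; rewrite -[RHS]uAg; apply: eq_bigr => i _.
by rewrite mxE enum_rankK gE.
Qed.
End AlgebraicDependence.

(** * Upper bound on the depth of a monomial quotient *)

Section QuotientRegular.
Variables (R : comNzRingType) (G : R -> Prop).
Implicit Types (f : seq R) (p : R).

Lemma ideal_gen_ideal : is_ideal (ideal_gen G).
Proof.
split; first exact: ideal_gen0.
  by move=> x y Gx Gy; rewrite -[x]mul1r; exact: ideal_gen_lin.
by move=> a x Gx; rewrite -[_ * _]addr0; apply: ideal_gen_lin (ideal_gen0 G).
Qed.

Lemma quot_ideal_piP (x : quot_ideal G) : exists p, x = quot_ideal_pi G p.
Proof. by exists (repr x); rewrite /quot_ideal_pi repr_quotmodK. Qed.

Lemma quot_ideal_pi_eq p q :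
  quot_ideal_pi G p = quot_ideal_pi G q <-> ideal_gen G (p - q).
Proof. by rewrite proj_quotmod_eq; split=> /asboolP. Qed.

Lemma quot_ideal_piZ a p : a *: quot_ideal_pi G p = quot_ideal_pi G (a * p).
Proof. exact: (esym (proj_quotmodZ (ideal_pred G) a (p : R^o))). Qed.

Lemma in_seq_mul_pi f p :
  in_seq_mul f (quot_ideal_pi G p) <-> ideal_adjs (ideal_gen G) f p.
Proof.
have sumE (q : nat -> R) : \sum_(j < size f) f`_j *: quot_ideal_pi G (q j) =
    quot_ideal_pi G (\sum_(j < size f) f`_j * q j).
  rewrite [RHS](raddf_sum (proj_quotmod (ideal_pred G))).
  by apply: eq_bigr => j _; rewrite quot_ideal_piZ.
rewrite ideal_adjsP; split=> [[m pE]|[m Im]].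
  have [q qE] := choice (fun j => quot_ideal_piP (m j)).
  exists q; apply/quot_ideal_pi_eq; rewrite pE -sumE.
  by apply: eq_bigr => j _; rewrite -qE.
by exists (fun j => quot_ideal_pi G (m j)); rewrite sumE; apply/quot_ideal_pi_eq.
Qed.

Lemma regular_seqP f : regular_seq (quot_ideal G) f <->
  wregular (ideal_gen G) f /\ exists p, ~ ideal_adjs (ideal_gen G) f p.
Proof.
rewrite /regular_seq wregularP; split=> -[rf [x nx]]; split.
- move=> i lti p; rewrite -!in_seq_mul_pi -quot_ideal_piZ; exact: rf.
- by have [p xp] := quot_ideal_piP x; exists p; rewrite -in_seq_mul_pi -xp.
- move=> i lti y; have [p ->] := quot_ideal_piP y.
  by rewrite quot_ideal_piZ !in_seq_mul_pi; exact: rf.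
- by exists (quot_ideal_pi G x); rewrite in_seq_mul_pi.
Qed.

End QuotientRegular.

(** * Monomial ideals *)

Section MonomialIdeal.
Variables (k : fieldType) (N n : nat) (m : 'I_n -> 'X_{1..N}).
Local Notation S := {mpoly k[N]}.
Implicit Types (p : S).

(** Membership is tested on the support, which avoids choosing coefficients; [ideal_gen_monomial]
    identifies it with the generated ideal. *)
Definition monomial_ideal p := forall nu, nu \in msupp p -> exists i, (m i <= nu)%MM.

Lemma monomial_ideal_ideal : is_ideal monomial_ideal.
Proof.
split=> [nu|p q Ip Iq nu|a p Ip nu]; first by rewrite msupp0.
  by move=> /msuppD_le; rewrite mem_cat => /orP[/Ip|/Iq].
move=> /msuppM_le /allpairsP [[mu1 mu2] /= [_ /Ip [i le_i] ->]].
by exists i; apply: lepm_trans le_i (lem_addl _ _).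
Qed.

Lemma monomial_idealX nu : monomial_ideal 'X_[nu] <-> exists i, (m i <= nu)%MM.
Proof. by split=> [|I mu]; [apply; rewrite msuppX inE | rewrite msuppX inE => /eqP ->]. Qed.

Lemma monomial_ideal_sum p : monomial_ideal p <->
  exists q : 'I_n -> S, p = \sum_(i < n) q i * 'X_[m i].
Proof.
split=> [Ip|[q ->]]; last first.
  have [I0 ID IM] := monomial_ideal_ideal.
  apply: (big_ind monomial_ideal) => // i _; apply/IM/monomial_idealX.
  by exists i; apply: lepm_refl.
pose h nu i := [pick i | (m i <= nu)%MM] == Some i.
exists (fun i => \sum_(nu <- msupp p | h nu i) p@_nu *: 'X_[nu - m i]).
under eq_bigr => i _ do rewrite mulr_suml big_mkcond.
rewrite exchange_big /= [LHS]mpolyE big_seq [RHS]big_seq; apply: eq_bigr => nu nup.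
rewrite /h; case: pickP => [i le_i|no]; last by case: (Ip nu nup) => i; rewrite no.
rewrite -big_mkcond (big_pred1 i) => [|j]; last by rewrite eq_sym.
by rewrite -scalerAl -mpolyXD submK.
Qed.

Lemma ideal_gen_monomial (G : S -> Prop) :
    (forall p, G p <-> exists i, p = 'X_[m i]) ->
  forall p, ideal_gen G p <-> monomial_ideal p.
Proof.
move=> GE p; split=> [[r [c [g [Gg ->]]]]|/monomial_ideal_sum [q ->]].
  have [I0 ID IM] := monomial_ideal_ideal.
  apply: (big_ind monomial_ideal) => // i _; apply: IM.
  by have /GE [j ->] := Gg i; apply/monomial_idealX; exists j; apply: lepm_refl.
by exists n, q, (fun i => 'X_[m i]); split=> // i; apply/GE; exists i.
Qed.

End MonomialIdeal.

Section MaxIdeal.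
Variables (k : fieldType) (N : nat).
Local Notation S := {mpoly k[N]}.
Lemma max_idealP (p : S) : max_ideal p <-> p@_0%MM = 0.
Proof.
have -> : max_ideal p <-> monomial_ideal (fun i : 'I_N => U_(i)%MM) p.
  exact: ideal_gen_monomial.
split=> [Ip|p0 nu].
  by apply: memN_msupp_eq0; apply/negP => /Ip [i]; rewrite lep1mP mnm0E.
rewrite mcoeff_msupp => nup; suff /existsP [i nui] : [exists i, nu i != 0%N].
  by exists i; rewrite lep1mP.
apply: contraR nup; rewrite negb_exists => /forallP nu0; rewrite -p0.
by rewrite (_ : nu = 0%MM) //; apply/mnmP => i; rewrite mnm0E; have := nu0 i; rewrite negbK => /eqP.
Qed.

End MaxIdeal.

Section DepthUpperBound.
Variables (k : fieldType) (N n : nat) (m : 'I_n -> 'X_{1..N}).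
Local Notation S := {mpoly k[N]}.
Variable G : S -> Prop.
Hypothesis GE : forall p, G p <-> exists i, p = 'X_[m i].

Lemma msupp_exp_deg (a : S) t : max_ideal a -> {in msupp (a ^+ t), forall nu, t <= mdeg nu}%N.
Proof.
move=> /max_idealP a0; elim: t => [//|t IH] nu.
rewrite exprS => /msuppM_le /allpairsP [[mu1 mu2] /= [mu1a /IH mu2a ->]].
rewrite mdegD; suff : (0 < mdeg mu1)%N by lia.
rewrite lt0n mdeg_eq0; apply: contraL mu1a => /eqP ->.
by rewrite mcoeff_msupp a0 eqxx.
Qed.

(** If f were longer, powers of its elements would satisfy a relation all of whose monomials involve
    a variable of C, and this relation times w lies in the ideal. The powers exceed the degree of w,
    so w stays outside I + (f') and [wregular_independent] forbids the relation. *)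
Lemma regular_seq_size (C : pred 'I_N) (w : 'X_{1..N}) (f : seq S) :
    (forall j, ~~ (m j <= w)%MM) ->
    (forall i, C i -> exists j, (m j <= w + U_(i))%MM) ->
    {in f, forall a, max_ideal a} -> regular_seq (quot_ideal G) f ->
  (size f <= #|[predC C]|)%N.
Proof.
move=> wI wC fm /regular_seqP [wf _]; rewrite leqNgt; apply/negP => ltf.
have {}wf : wregular (monomial_ideal (k := k) m) f.
  by apply: wregular_ext wf => p; apply: ideal_gen_monomial.
set f' := [seq a ^+ (mdeg w).+1 | a <- f].
have szf : size f' = size f by rewrite size_map.
have wf' : wregular (monomial_ideal m) f'.
  exact: wregular_exp (monomial_ideal_ideal _ _) wf.
have [|s [c [e e_s ce] c0]] := @algebraic_dependence k N [predC C] f'; first by rewrite szf.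
have nw : ~ ideal_adjs (monomial_ideal m) f' 'X_[w].
  rewrite ideal_adjsP => -[q Iq]; have /eqP [] := oner_neq0 k.
  have : ('X_[w] - \sum_(j < size f') f'`_j * q j)@_w = 0.
    by apply: memN_msupp_eq0; apply/negP => /Iq [j]; apply/negP.
  rewrite mcoeffB mcoeffX eqxx raddf_sum big1 ?subr0 // => j _.
  apply: memN_msupp_eq0; apply/negP => /msuppM_le /allpairsP [[mu1 mu2] /= [mu1a _ wE]].
  have lj : (j < size f)%N by rewrite -szf.
  have /(congr1 mdeg) := wE; rewrite mdegD; move: mu1a; rewrite (nth_map 0) //.
  by move=> /(msupp_exp_deg (fm _ (mem_nth _ lj))); lia.
suff /wregular_independent - /(_ _ wf' nw) cz : monomial_ideal m
    (\sum_(e <- exponents s (size f')) c e *: power_prod f' e * 'X_[w]).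
  by move: ce; rewrite cz ?eqxx //; apply: monomial_ideal_ideal.
rewrite -mulr_suml => nu /msuppM_le /allpairsP [[mu1 mu2] /= [mu1F mu2w ->]].
move: mu2w; rewrite msuppX inE => /eqP ->.
have [i Ci mu1i] : exists2 i, C i & mu1 i != 0%N.
  apply/exists_inP; apply: contraLR mu1F; rewrite negb_exists => /forallP mu1D.
  rewrite mcoeff_msupp c0 ?eqxx // => i /=; rewrite negbK => Ci.
  by have := mu1D i; rewrite negb_and => /orP[/negP[]|/negPn/eqP].
have [j le_j] := wC i Ci; exists j; apply: lepm_trans le_j _.
apply/mnm_lepP => l; rewrite !mnmDE mnm1E addnC leq_add2r.
by case: eqVneq => // <-; rewrite lt0n.
Qed.

End DepthUpperBound.

(** * The Taylor complex *)

Section Taylor.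
Variables (k : fieldType) (N n : nat) (m : 'I_n -> 'X_{1..N}).
Local Notation S := {mpoly k[N]}.
Implicit Types (A B : {set 'I_n}) (mu nu : 'X_{1..N}) (v w : {set 'I_n} -> S).

Definition lcm_mnm A : 'X_{1..N} := [multinom \max_(s in A) m s i | i < N].

Lemma lcm_mnm_leP A mu : reflect (forall s, s \in A -> (m s <= mu)%MM) (lcm_mnm A <= mu)%MM.
Proof.
apply: (iffP mnm_lepP) => [le_mu s sA|le_mu i]; last first.
  by rewrite mnmE; apply/bigmax_leqP => s /le_mu /mnm_lepP.
apply/mnm_lepP => i; apply: leq_trans (le_mu i).
by rewrite mnmE (bigD1 s) //= leq_maxl.
Qed.

Lemma lcm_mnm_subset A B : A \subset B -> (lcm_mnm A <= lcm_mnm B)%MM.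
Proof.
move=> AB; apply/lcm_mnm_leP => s sA.
by have /lcm_mnm_leP := lepm_refl (lcm_mnm B); apply; apply: (subsetP AB).
Qed.

Lemma lcm_mnm1 s : lcm_mnm [set s] = m s.
Proof. by apply/mnmP => i; rewrite mnmE big_set1. Qed.

Lemma lcm_mnm0 : lcm_mnm set0 = 0%MM.
Proof. by apply/mnmP => i; rewrite mnmE big_set0 mnm0E. Qed.

Lemma lcm_mnm2 s t : lcm_mnm [set s; t] = mlcm (m s) (m t).
Proof.
apply/mnmP => i; rewrite !mnmE; have [->|st] := eqVneq s t.
  by rewrite setUid big_set1 maxnn.
by rewrite big_setU1 ?inE //= big_set1.
Qed.

Definition taylor_sign (j : 'I_n) B : k := (-1) ^+ #|[set b in B | (b < j)%N]|.

Lemma taylor_sign_swap (j l : 'I_n) B : j \notin B -> (j < l)%N ->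
  taylor_sign l (j |: B) = - taylor_sign l B /\ taylor_sign j (l |: B) = taylor_sign j B.
Proof.
move=> jB jl; rewrite /taylor_sign; split.
  rewrite (_ : finset _ = j |: [set b in B | (b < l)%N]); last first.
    by apply/setP => b; rewrite !inE; case: eqP => //= ->.
  by rewrite cardsU1 !inE (negbTE jB) exprS mulN1r.
congr (_ ^+ #|pred_of_set _|); apply/setP => b; rewrite !inE.
by case: eqP => //= ->; rewrite ltnNge ltnW ?andbF.
Qed.

(** A chain of any dimension is a function [v] on all subsets, standing for the sum of v A e_A; this
    is the coefficient at e_B of its boundary. *)
Definition taylor_dif v B : S :=
  \sum_(j | j \notin B)
    taylor_sign j B *: (v (j |: B) * 'X_[lcm_mnm (j |: B) - lcm_mnm B]).

(* The coefficient of v A *: e_A in multidegree mu. *)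
Definition multicoef v A mu : k :=
  if (lcm_mnm A <= mu)%MM then (v A)@_(mu - lcm_mnm A) else 0.

Lemma mcoeffMX_sub (p : S) d nu :
  (p * 'X_[d])@_nu = if (d <= nu)%MM then p@_(nu - d) else 0.
Proof.
case: ifPn => [dnu|dnu]; first by rewrite -[in LHS](submK dnu) addmC mcoeffMX.
apply: memN_msupp_eq0; rewrite (perm_mem (msuppMX _ _)); apply/mapP => -[mu _ nuE].
by rewrite nuE lem_addr in dnu.
Qed.

(** In a fixed multidegree the monomial factors disappear and the differential becomes the
    simplicial boundary over k. *)
Lemma multicoef_dif v B mu : (lcm_mnm B <= mu)%MM ->
  multicoef (taylor_dif v) B mu =
    \sum_(j | j \notin B) taylor_sign j B * multicoef v (j |: B) mu.
Proof.
move=> Bmu; rewrite /multicoef Bmu raddf_sum; apply: eq_bigr => j jB /=.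
have BjB := lcm_mnm_subset (subsetUr [set j] B).
rewrite mcoeffZ mcoeffMX_sub; congr (_ * _).
have -> : (lcm_mnm (j |: B) - lcm_mnm B <= mu - lcm_mnm B)%MM = (lcm_mnm (j |: B) <= mu)%MM.
  apply/mnm_lepP/mnm_lepP => h i; have := h i; rewrite !mnmBE;
    by move/mnm_lepP: Bmu => /(_ i); move/mnm_lepP: BjB => /(_ i); lia.
case: ifP => // /mnm_lepP jBmu; congr (_@_ _); apply/mnmP => i; rewrite !mnmBE.
by move/mnm_lepP: Bmu => /(_ i); move/mnm_lepP: BjB => /(_ i); have := jBmu i; lia.
Qed.

Lemma multicoefP v w : (forall A mu, (lcm_mnm A <= mu)%MM -> multicoef v A mu = multicoef w A mu) ->
  forall A, v A = w A.
Proof.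
move=> vw A; apply/mpolyP => nu; have := vw A (nu + lcm_mnm A)%MM (lem_addl _ _).
by rewrite /multicoef lem_addl addmK.
Qed.

(** Inserting j and l in the two orders gives opposite signs, so the terms for (j, l) and (l, j)
    cancel. *)
Lemma taylor_dif_dif v B : taylor_dif (taylor_dif v) B = 0.
Proof.
move: B; apply: (@multicoefP _ (fun=> 0)) => B mu Bmu.
rewrite [RHS]/multicoef mcoeff0 if_same multicoef_dif //.
pose T j l := taylor_sign j B * (taylor_sign l (j |: B) * multicoef v (l |: (j |: B)) mu).
have -> : \sum_(j | j \notin B) taylor_sign j B * multicoef (taylor_dif v) (j |: B) mu =
    \sum_(j | j \notin B) \sum_(l | (l != j) && (l \notin B)) T j l.
  apply: eq_bigr => j jB; rewrite /T -mulr_sumr; congr (_ * _).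
  have [le_mu|nle_mu] := boolP (lcm_mnm (j |: B) <= mu)%MM.
    by rewrite multicoef_dif //; apply: eq_bigl => l; rewrite !inE negb_or.
  rewrite {1}/multicoef (negbTE nle_mu) big1 // => l _.
  rewrite /multicoef; case: ifP => [le_mu|]; last by rewrite mulr0.
  case/negP: nle_mu; apply: lepm_trans le_mu.
  by apply: lcm_mnm_subset; apply: subsetUr.
rewrite pair_big_dep /= (bigID (fun p : 'I_n * 'I_n => (p.1 < p.2)%N)) /=.
rewrite [X in _ + X](reindex_inj (inv_inj (@swap_pairK _ _))) /=.
rewrite [X in _ + X](eq_bigl (fun p : 'I_n * 'I_n =>
  [&& p.1 \notin B, (p.2 != p.1) & p.2 \notin B] && (p.1 < p.2)%N)); last first.
  move=> [j l] /=; rewrite -leqNgt leq_eqVlt eq_sym.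
  by case: (j \in B); case: (l \in B); rewrite ?andbF //= -val_eqE /= eq_sym; case: ltngtP.
rewrite -big_split big1 //= => -[j l] /= /andP[/and3P[jB _ lB] jl].
have [e1 e2] := taylor_sign_swap jB jl; rewrite /T e1 e2 setUCA.
by rewrite mulNr mulrN mulrCA addNr.
Qed.

Lemma taylor_dif_set0 v :
  taylor_dif v set0 = \sum_j v [set j] * 'X_[m j].
Proof.
apply: eq_big => [j|j _]; first by rewrite inE.
rewrite setU0 lcm_mnm1 lcm_mnm0 subm0 /taylor_sign (_ : finset _ = set0).
  by rewrite cards0 scale1r.
by apply/setP => b; rewrite !inE.
Qed.

Lemma mpoly_of_coef (E : 'X_{1..N} -> k) K :
  (forall nu, (K <= mdeg nu)%N -> E nu = 0) -> exists p : S, forall nu, p@_nu = E nu.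
Proof.
move=> EK; exists (\sum_(nu : 'X_{1..N < K}) E nu *: 'X_[nu]) => nu.
have [Knu|] := leqP K (mdeg nu); last exact: mcoeff_mpoly.
rewrite EK // raddf_sum big1 // => mu _; rewrite /= mcoeffZ mcoeffX.
by case: eqP => [e|_]; rewrite ?mulr0 // EK ?mul0r // e.
Qed.

(* In multidegree mu the complex is that of the full simplex on [set s | m s <= mu]; *)
(* the witness w is the cone over the least vertex of that simplex.                  *)
Lemma taylor_exact v : (forall B, taylor_dif v B = 0) -> 
  exists w, (forall A, A != set0 -> v A = taylor_dif w A) /\
    (forall A, w A != 0 -> exists2 a, a \in A & v (A :\ a) != 0).
Proof.
move=> dv.
pose apex mu a := (m a <= mu)%MM && [forall b : 'I_n, (m b <= mu)%MM ==> (a <= b)%N].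
pose W A mu := \sum_(a in A | apex mu a) multicoef v (A :\ a) mu.
have [w wE] : exists w, forall A nu, (w A)@_nu = W A (nu + lcm_mnm A)%MM.
  have [|w wE] := choice (P := fun A p => forall nu, p@_nu = W A (nu + lcm_mnm A)%MM).
    move=> A; apply: (@mpoly_of_coef _ (\max_B msize (v B))%N) => nu Knu.
    rewrite /W big1 // => a /andP[aA _]; rewrite /multicoef; case: ifP => // _.
    apply/memN_msupp_eq0/msize_mdeg_ge.
    apply: leq_trans (leq_bigmax (A :\ a)) (leq_trans Knu _).
    rewrite !mdegE; apply: leq_sum => i _; rewrite mnmBE mnmDE.
    by have /mnm_lepP/(_ i) := lcm_mnm_subset (subsetDl A [set a]); lia.
  by exists w.
have WE A mu : (lcm_mnm A <= mu)%MM -> multicoef w A mu = W A mu.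
  by move=> Amu; rewrite /multicoef Amu wE submK.
exists w; split=> [A A0|A wA]; last first.
  have [nu nuw] : exists nu, (w A)@_nu != 0.
    by exists (mlead (w A)); rewrite mleadc_eq0.
  have [a /andP[aA _] va] : exists2 a, (a \in A) && apex (nu + lcm_mnm A)%MM a
      & multicoef v (A :\ a) (nu + lcm_mnm A)%MM != 0.
    apply/exists_inP; apply: contraR nuw => /exists_inPn /= h.
    by rewrite wE /W big1 // => a ha; apply/eqP; move: (h a ha); rewrite negbK.
  exists a => //; apply: contraNneq va => va0.
  by rewrite /multicoef va0 mcoeff0 if_same.
apply/mpolyP => nu; set mu := (nu + lcm_mnm A)%MM.
have Amu : (lcm_mnm A <= mu)%MM by apply: lem_addl.
suff : multicoef v A mu = multicoef (taylor_dif w) A mu.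
  by rewrite /multicoef Amu /mu addmK.
have [a /andP[amu /forallP amin]] : exists a, apex mu a.
  have /set0Pn [b bA] := A0; have bmu : (m b <= mu)%MM by move/lcm_mnm_leP: Amu; apply.
  case: (@arg_minnP _ b (fun s => m s <= mu)%MM val bmu) => a amu amin.
  by exists a; rewrite /apex amu; apply/forallP => c; apply/implyP => /amin.
have apexE c : apex mu c = (c == a).
  apply/andP/eqP => [[cmu /forallP cmin]|->]; last by split=> //; apply/forallP.
  apply: val_inj; apply/eqP; rewrite /= eqn_leq.
  by rewrite (implyP (cmin a) amu) (implyP (amin c) cmu).
have {}WE B : multicoef w B mu = if (lcm_mnm B <= mu)%MM && (a \in B) then multicoef v (B :\ a) mu else 0.
  have [Bmu|Bmu] := boolP (lcm_mnm B <= mu)%MM; last by rewrite /multicoef (negbTE Bmu).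
  rewrite WE // /W; case: ifP => aB /=.
    by rewrite (big_pred1 a) // => c; rewrite apexE; apply: andb_idl => /eqP ->.
  by rewrite big1 // => c /andP[cB]; rewrite apexE => /eqP ca; rewrite -ca cB in aB.
have sign1 B : (lcm_mnm B <= mu)%MM -> taylor_sign a B = 1.
  move=> /lcm_mnm_leP Bmu; rewrite /taylor_sign (_ : finset _ = set0) ?cards0 //.
  apply/setP => b; rewrite !inE; apply/negP => /andP[/Bmu bmu].
  by rewrite ltnNge (implyP (amin b) bmu).
have lcmU j B : (lcm_mnm (j |: B) <= mu)%MM = (m j <= mu)%MM && (lcm_mnm B <= mu)%MM.
  apply/lcm_mnm_leP/andP => [h|[jmu /lcm_mnm_leP Bmu] s].
    split; first by apply: h; rewrite !inE eqxx.
    by apply/lcm_mnm_leP => s sB; apply: h; rewrite !inE sB orbT.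
  by rewrite !inE => /orP[/eqP->|/Bmu].
(* If a is not in A, only j = a contributes, because w vanishes in this multidegree on sets avoiding
   a. If a is in A, the cycle condition at A :\ a expresses v A through the sets j |: (A :\ a). *)
rewrite multicoef_dif //; have [aA|aA] := boolP (a \in A); last first.
  rewrite (bigD1 a) //= sign1 // mul1r WE lcmU amu Amu !inE eqxx /= setU1K //.
  rewrite big1 ?addr0 // => j /andP[jA ja]; rewrite WE !inE (negbTE aA) eq_sym (negbTE ja).
  by rewrite andbF mulr0.
have Aamu : (lcm_mnm (A :\ a) <= mu)%MM.
  by apply: lepm_trans Amu; apply: lcm_mnm_subset; apply: subsetDl.
have := multicoef_dif v Aamu; rewrite {1}/multicoef Aamu dv mcoeff0.
rewrite (bigD1 a) ?inE ?eqxx //= sign1 // mul1r setD1K // => /esym/eqP.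
rewrite addr_eq0 => /eqP ->; rewrite -sumrN; apply: eq_big => j.
  by rewrite !inE; case: eqP => [->|] /=; rewrite ?aA ?andbT.
rewrite !inE => /andP[jAa ja]; have jA : j \notin A by move: jAa; rewrite ja.
have aj : a \notin A :\ a by rewrite !inE eqxx.
rewrite WE lcmU Amu andbT !inE aA orbT andbT.
case: ifPn => [jmu|jmu]; last first.
  by rewrite mulr0 /multicoef lcmU (negbTE jmu) mulr0 oppr0.
have -> : (j |: A) :\ a = j |: (A :\ a).
  by apply/setP => b; rewrite !inE; case: eqP => //= ->; rewrite eq_sym (negbTE ja).
have aj' : (a < j)%N by rewrite ltn_neqAle eq_sym ja; exact: (implyP (amin j) jmu).
have [+ _] := taylor_sign_swap aj aj'; rewrite setD1K // => ->.
by rewrite mulNr.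
Qed.

End Taylor.

(** * Lower bound on the depth of a monomial quotient *)

(** The coefficients q form a Taylor cycle supported on singletons; exactness makes it the boundary
    of a chain on pairs. *)
Lemma monomial_syzygy (k : fieldType) (N n : nat) (m : 'I_n -> 'X_{1..N})
    (q : 'I_n -> {mpoly k[N]}) :
    \sum_(s < n) q s * 'X_[m s] = 0 ->
  exists r : 'I_n -> 'I_n -> {mpoly k[N]}, forall s,
    q s = \sum_(t < n) (r s t - r t s) * 'X_[mlcm (m s) (m t) - m s].
Proof.
move=> q0; pose v (A : {set 'I_n}) := \sum_(s | A == [set s]) q s.
have v1 s : v [set s] = q s.
  by rewrite /v (big_pred1 s) // => t /=; rewrite (inj_eq set1_inj) eq_sym.
have dv B : taylor_dif m v B = 0.
  have [->|/set0Pn [b bB]] := eqVneq B set0; last first.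
    rewrite /taylor_dif big1 // => j jB; rewrite {1}/v big_pred0 ?mul0r ?scaler0 // => s.
    apply/eqP => jBs; have : j \in [set s] by rewrite -jBs setU11.
    have : b \in [set s] by rewrite -jBs !inE bB orbT.
    by rewrite !inE => /eqP bs /eqP js; rewrite js -bs bB in jB.
  by rewrite taylor_dif_set0 -[RHS]q0; apply: eq_bigr => j _; rewrite v1.
have [w [vw _]] := taylor_exact dv.
(* Each pair is stored once, larger index first; the difference r s t - r t s then supplies the
   Taylor sign. *)
exists (fun s t : 'I_n => if (t < s)%N then w [set s; t] else 0) => s.
rewrite -v1 vw; last by apply/set0Pn; exists s; rewrite inE.
rewrite /taylor_dif big_mkcond /=; apply: eq_bigr => t _; rewrite inE.
have [->|ts] := eqVneq t s; first by rewrite subrr mul0r.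
rewrite /= lcm_mnm1 setUC lcm_mnm2 [in taylor_sign _ _]/taylor_sign.
case: ltngtP ts => // [ts _|st _|/val_inj -> /eqP //].
  rewrite (_ : finset _ = set0) ?cards0 ?scale1r ?subr0 //.
  by apply/setP => b; rewrite !inE; case: eqP => //= ->; rewrite ltnNge ltnW.
rewrite (_ : finset _ = [set s]) ?cards1 ?scaleN1r ?sub0r 1?setUC ?mulNr //.
by apply/setP => b; rewrite !inE; case: eqP => //= ->; rewrite st.
Qed.

(** * Substituting variables for variables *)

Section VariableSubstitution.
Variables (k : fieldType) (N : nat).
Local Notation S := {mpoly k[N]}.
Implicit Types (tau sigma : 'I_N -> 'I_N) (mu nu : 'X_{1..N}) (p q : S).

Definition mnm_subst tau mu : 'X_{1..N} := [multinom \sum_(i | tau i == l) mu i | l < N]%N.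

Definition var_subst tau : S -> S := mmap (@mpolyC N k) (fun i => 'X_(tau i)).

HB.instance Definition _ tau := GRing.RMorphism.on (var_subst tau).

Lemma mnm_substD tau mu nu :
  mnm_subst tau (mu + nu) = (mnm_subst tau mu + mnm_subst tau nu)%MM.
Proof.
by apply/mnmP => l; rewrite mnmDE !mnmE -big_split; apply: eq_bigr => i _; rewrite mnmDE.
Qed.

Lemma mnm_subst_comp tau sigma mu :
  mnm_subst tau (mnm_subst sigma mu) = mnm_subst (tau \o sigma) mu.
Proof.
apply/mnmP => l; rewrite !mnmE; under eq_bigr => i _ do rewrite mnmE.
rewrite (exchange_big_dep xpredT) //= [RHS]big_mkcond; apply: eq_bigr => j _ /=.
case: ifP => jl.
  rewrite (big_pred1 (sigma j)) // => i; rewrite /= [sigma j == i]eq_sym.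
  by apply: andb_idl => /eqP ->.
by rewrite big_pred0 // => i; apply/negP => /andP[/eqP il /eqP ji]; rewrite ji il eqxx in jl.
Qed.

Lemma var_substX tau mu : var_subst tau 'X_[mu] = 'X_[mnm_subst tau mu].
Proof.
rewrite /var_subst mmapX /mmap1 mprodXnE; congr 'X_[_]; apply/mnmP => l.
rewrite [RHS]mnmE mnm_sumE [RHS]big_mkcond; apply: eq_bigr => i _.
by rewrite mulmnE mnm1E; case: eqP => _; rewrite ?mul1n ?mul0n.
Qed.

Lemma var_substC tau c : var_subst tau c%:MP = c%:MP.
Proof. exact: mmapC. Qed.

Lemma var_subst1 tau i : var_subst tau 'X_i = 'X_(tau i).
Proof. by rewrite /var_subst mmapX mmap1U. Qed.

Lemma var_subst_comp tau sigma p :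
  var_subst tau (var_subst sigma p) = var_subst (tau \o sigma) p.
Proof.
elim/mpolyind: p => [|c mu p _ _ IH]; first by rewrite !rmorph0.
rewrite !rmorphD /= IH -!mul_mpolyC !rmorphM /= !var_substC !var_substX.
by rewrite mnm_subst_comp.
Qed.

Lemma var_subst_id tau p : tau =1 id -> var_subst tau p = p.
Proof.
move=> tid; elim/mpolyind: p => [|c mu p _ _ IH]; first by rewrite rmorph0.
rewrite rmorphD /= IH -!mul_mpolyC rmorphM /= var_substC var_substX; congr (_ * 'X_[_] + _).
by apply/mnmP => l; rewrite mnmE (big_pred1 l) // => i /=; rewrite tid.
Qed.

Lemma var_subst_ext tau sigma : tau =1 sigma -> var_subst tau =1 var_subst sigma.
Proof. by move=> /funext ->. Qed.

Definition var_diff (z y : 'I_N) : S := 'X_z - 'X_y.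
Definition merge z y : 'I_N -> 'I_N := fun i => if i == z then y else i.

Lemma merge_var_diff z y : var_subst (merge z y) (var_diff z y) = 0.
Proof.
rewrite rmorphB /= !var_subst1 /merge eqxx.
by case: eqP => [->|_]; rewrite subrr.
Qed.

Lemma merge_congr z y p : exists e, p = var_subst (merge z y) p + var_diff z y * e.
Proof.
pose P (p : S) := exists e, p = var_subst (merge z y) p + var_diff z y * e.
have PD q r : P q -> P r -> P (q + r).
  move=> [e1 E1] [e2 E2]; exists (e1 + e2).
  by rewrite {1}E1 {1}E2 rmorphD /=; ring.
have PM q r : P q -> P r -> P (q * r).
  move=> [e1 E1] [e2 E2]; set q' := var_subst _ q in E1; set r' := var_subst _ r in E2.
  exists (e1 * r' + q' * e2 + var_diff z y * e1 * e2).
  by rewrite {1}E1 {1}E2 rmorphM /= -/q' -/r'; ring.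
have PC c : P c%:MP by exists 0; rewrite var_substC mulr0 addr0.
have PX i : P 'X_i.
  rewrite /P var_subst1 /merge; case: eqP => [->|_]; last by exists 0; rewrite mulr0 addr0.
  by exists 1; rewrite /var_diff; ring.
rewrite -/(P p); elim/mpolyind: p => [|c mu p _ _ IH]; first exact: (PC 0).
apply: PD IH; rewrite -mul_mpolyC; apply: (PM _ _ (PC c)); rewrite mpolyXE_id.
apply: (big_ind P (PC 1) PM) => i _.
by elim: (mu i) => [|t IHt]; [apply: (PC 1) | rewrite exprS; apply: PM].
Qed.

Lemma var_diff_neq0 z y : z != y -> var_diff z y != 0.
Proof.
move=> zy; apply: contraNneq zy => /(congr1 (mcoeff U_(z))).
rewrite mcoeffB !mcoeffXU eqxx mcoeff0 [y == z]eq_sym; case: (z == y) => //.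
by rewrite subr0 => /eqP; rewrite oner_eq0.
Qed.

End VariableSubstitution.

Section DepthLowerBound.
Variables (k : fieldType) (N n : nat) (m : 'I_n -> 'X_{1..N}).
Local Notation S := {mpoly k[N]}.
Implicit Types (tau sigma : 'I_N -> 'I_N) (p q : S).

(* The substitution tau keeps m s / gcd and m t / gcd coprime, hence commutes with lcms. *)
Definition lcm_preserving tau := forall s t a b,
  (m t a < m s a)%N -> (m s b < m t b)%N -> tau a != tau b.

(** On each fibre of [tau] one of the two exponents dominates throughout, so the sum of the maxima
    is the maximum of the sums. *)
Lemma mnm_subst_lcm tau s t : lcm_preserving tau ->
  mnm_subst tau (mlcm (m s) (m t)) = mlcm (mnm_subst tau (m s)) (mnm_subst tau (m t)).
Proof.
move=> tau_lcm; apply/mnmP => l; rewrite !mnmE; under eq_bigr => i _ do rewrite mnmE.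
have [/exists_inP [a la ta]|] := boolP [exists (a | tau a == l), m t a < m s a]%N.
  have le_ts i : tau i == l -> (m t i <= m s i)%N.
    move=> li; rewrite leqNgt; apply/negP => ti.
    by have /eqP[] := tau_lcm _ _ _ _ ta ti; rewrite (eqP la) (eqP li).
  rewrite (maxn_idPl _); last exact: leq_sum.
  by apply: eq_bigr => i /le_ts /maxn_idPl.
move=> /exists_inPn le_st.
have {}le_st i : tau i == l -> (m s i <= m t i)%N by move=> /le_st; rewrite -leqNgt.
rewrite (maxn_idPr _); last exact: leq_sum.
by apply: eq_bigr => i /le_st /maxn_idPr.
Qed.

(* The ideal I + (X_i - X_(tau i))_i, when tau is idempotent. *)
Definition merged_ideal tau p := monomial_ideal (fun s => mnm_subst tau (m s)) (var_subst tau p).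

Section OneStep.
Variables (tau : 'I_N -> 'I_N) (z y : 'I_N).
Hypotheses (tauz : tau z = z) (tauy : tau y = y) (zy : z != y).
Let tau' := merge z y \o tau.

(** Write (X_z - X_y) p as a combination of the generators. Merging z into y turns the coefficients
    into a syzygy, which is a combination of pair syzygies. As lcms are preserved, these lift to
    pair syzygies before the merge and contribute nothing there, so the combination is a multiple of
    X_z - X_y, which cancels. *)
Lemma merged_ideal_regular : lcm_preserving tau' ->
  forall p, merged_ideal tau (var_diff k z y * p) -> merged_ideal tau p.
Proof.
move=> tau_lcm p; rewrite /merged_ideal rmorphM /= rmorphB /= !var_subst1 tauz tauy.
rewrite -/(var_diff k z y) => /monomial_ideal_sum [q qE].
have := congr1 (var_subst (merge z y)) qE.
rewrite rmorphM /= merge_var_diff mul0r raddf_sum /=.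
under eq_bigr => s _ do rewrite rmorphM /= var_substX mnm_subst_comp.
move=> /esym /monomial_syzygy [r rE].
have qs s : exists es, q s =
    \sum_(t < n) (r s t - r t s) * 'X_[mnm_subst tau (mlcm (m s) (m t) - m s)]
    + var_diff k z y * es.
  have [e0 ->] := merge_congr z y (q s); rewrite rE.
  have [e eE] := choice (fun t : 'I_n =>
    merge_congr z y ('X_[mnm_subst tau (mlcm (m s) (m t) - m s)] : S)).
  exists (e0 - \sum_(t < n) (r s t - r t s) * e t).
  rewrite mulrBr mulr_sumr addrCA addrC; congr (_ + _).
  rewrite -sumrB; apply: eq_bigr => t _.
  rewrite [X in _ = _ * X - _]eE var_substX mnm_subst_comp -/tau'.
  have -> : mnm_subst tau' (mlcm (m s) (m t) - m s) =
      (mlcm (mnm_subst tau' (m s)) (mnm_subst tau' (m t)) - mnm_subst tau' (m s))%MM.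
    rewrite -mnm_subst_lcm // -[in RHS](submK (lem_mlcml (m s) (m t))).
    by rewrite mnm_substD addmK.
  by ring.
have [e eE] := choice qs; move: qE; under eq_bigr => s _ do rewrite eE mulrDl.
rewrite big_split /= [X in X + _](_ : _ = 0) => [|]; last first.
  pose L s t : S := 'X_[mnm_subst tau (mlcm (m s) (m t))].
  transitivity (\sum_(s < n) \sum_(t < n) (r s t * L s t - r t s * L s t)).
    apply: eq_bigr => s _; rewrite mulr_suml; apply: eq_bigr => t _.
    by rewrite -mulrA -mpolyXD -mnm_substD submK ?lem_mlcml // mulrBl.
  under eq_bigr => s _ do rewrite sumrB.
  rewrite sumrB [X in _ - X]exchange_big /= -sumrB big1 // => s _.
  by rewrite -sumrB big1 // => t _; rewrite /L mlcmC subrr.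
rewrite add0r; under eq_bigr => s _ do rewrite -mulrA.
rewrite -mulr_sumr => /(mulfI (var_diff_neq0 k zy)) ->.
by apply/monomial_ideal_sum; exists e.
Qed.

(** One inclusion applies the further merge; the other replaces each monomial by its merged image up
    to a multiple of X_z - X_y. *)
Lemma merged_ideal_adj : (forall i, tau (tau i) = tau i) ->
  forall p, ideal_adj (merged_ideal tau) (var_diff k z y) p <-> merged_ideal tau' p.
Proof.
move=> tauK p.
have [I0 ID IM] := monomial_ideal_ideal k (fun s => mnm_subst tau (m s)).
have [I0' ID' IM'] := monomial_ideal_ideal k (fun s => mnm_subst tau' (m s)).
have tau_diff : var_subst tau (var_diff k z y) = var_diff k z y.
  by rewrite rmorphB /= !var_subst1 tauz tauy.
split=> [[u]|].
  rewrite /merged_ideal rmorphB rmorphM /= tau_diff => /monomial_ideal_sum [q].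
  move=> /(congr1 (var_subst (merge z y))).
  rewrite rmorphB rmorphM /= merge_var_diff mul0r subr0 var_subst_comp raddf_sum => ->.
  apply/monomial_ideal_sum; exists (fun s => var_subst (merge z y) (q s)).
  by apply: eq_bigr => s _; rewrite /= rmorphM /= var_substX mnm_subst_comp.
rewrite /merged_ideal => /monomial_ideal_sum [q qE].
have [e0 E0] := merge_congr z y (var_subst tau p).
rewrite var_subst_comp qE in E0.
have [e eE] := choice (fun s => merge_congr z y ('X_[mnm_subst tau (m s)] : S)).
pose u := e0 - \sum_(s < n) q s * e s.
have {}E0 : var_subst tau p = \sum_(s < n) q s * 'X_[mnm_subst tau (m s)] + var_diff k z y * u.
  rewrite E0 mulrBr mulr_sumr addrCA addrC; congr (_ + _).
  rewrite -sumrB; apply: eq_bigr => s _.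
  by rewrite [X in _ = _ * X - _]eE var_substX mnm_subst_comp; ring.
exists u; have : var_subst tau p - var_diff k z y * var_subst tau u =
    var_subst tau (\sum_(s < n) q s * 'X_[mnm_subst tau (m s)]).
  have tau2 : tau \o tau =1 tau by move=> i; apply: tauK.
  by rewrite -[var_subst tau p](var_subst_ext tau2) -var_subst_comp E0 rmorphD rmorphM /=
             tau_diff addrK.
move=> uE; rewrite /merged_ideal rmorphB /= rmorphM /= tau_diff uE.
apply/monomial_ideal_sum; exists (fun s => var_subst tau (q s)).
rewrite raddf_sum; apply: eq_bigr => s _ /=; rewrite rmorphM /= var_substX mnm_subst_comp.
by congr (_ * 'X_[mnm_subst _ _]); apply/funext => i; apply: tauK.
Qed.

End OneStep.

(** The list [l] records the variables already identified, so that the induction on [zs] moves one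
    variable at a time. *)
Lemma wregular_merge sigma (l zs : seq 'I_N) :
    (forall i, sigma (sigma i) = sigma i) -> lcm_preserving sigma ->
    {in l ++ zs, forall z, sigma z != z} -> uniq (l ++ zs) ->
  wregular (merged_ideal (fun i => if i \in l then sigma i else i))
    [seq var_diff k z (sigma z) | z <- zs].
Proof.
move=> sK sigma_lcm; elim: zs l => [//|z zs IH] l moved lz_uniq /=.
set tau := fun i => _.
have sz : sigma z != z by apply: moved; rewrite mem_cat inE eqxx orbT.
have sl i : (sigma i \in l) = false.
  by apply/negP => il; have := moved (sigma i); rewrite mem_cat il sK eqxx => /(_ isT).
have zl : (z \in l) = false.
  by apply/negP => zl; move: lz_uniq; rewrite cat_uniq /= zl /= andbF.
have tauz : tau z = z by rewrite /tau zl.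
have tauy : tau (sigma z) = sigma z by rewrite /tau sl.
have tauK i : tau (tau i) = tau i by rewrite /tau; case il: (i \in l); rewrite ?sl ?il.
pose tau' i := if i \in rcons l z then sigma i else i.
have tauE : merge z (sigma z) \o tau =1 tau'.
  move=> i; rewrite /= /merge /tau' /tau mem_rcons inE.
  case: (i \in l); last by rewrite orbF; case: eqP => // ->.
  by rewrite orbT; case: eqP => // e; move: sz; rewrite -e sK eqxx.
split.
  apply: merged_ideal_regular => //; first by rewrite eq_sym.
  (* [sigma] factors through the partial identification [tau'], so whatever [sigma] separates [tau']
     separates too. *)
  move=> s t a b sa tb; rewrite !tauE; apply: contraNneq (sigma_lcm _ _ _ _ sa tb).
  have sE i : sigma (tau' i) = sigma i by rewrite /tau'; case: ifP.
  by move=> e; rewrite -sE e sE.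
apply: (@wregular_ext _ _ (merged_ideal tau')); last first.
  by apply: IH; rewrite cat_rcons.
move=> p; rewrite -(funext tauE); apply: iff_sym.
exact: (merged_ideal_adj tauz tauy).
Qed.

Variable G : S -> Prop.
Hypothesis GE : forall p, G p <-> exists i, p = 'X_[m i].

Lemma regular_seq_exists sigma :
    (forall i, sigma (sigma i) = sigma i) -> lcm_preserving sigma ->
    (forall s, m s != 0%MM) ->
  exists f, [/\ size f = #|[pred i | sigma i != i]|, {in f, forall a, max_ideal a}
    & regular_seq (quot_ideal G) f].
Proof.
move=> sK sigma_lcm m0; pose zs := enum [pred i | sigma i != i].
have diff_max z : (var_diff k z (sigma z))@_0%MM = 0.
  by rewrite mcoeffB !mcoeffX !mnm1_eq0 subrr.
set f := [seq var_diff k z (sigma z) | z <- zs].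
have fm : {in f, forall a, max_ideal a} by move=> a /mapP [z _ ->]; apply/max_idealP.
exists f; split=> //; first by rewrite size_map -cardE.
apply/regular_seqP; split.
  have := @wregular_merge sigma [::] zs sK sigma_lcm.
  rewrite cat0s enum_uniq => /(_ _ isT) w.
  apply: (@wregular_ext _ _ (merged_ideal id)); last first.
    by apply: w => z; rewrite mem_enum.
  move=> p; rewrite (ideal_gen_monomial GE) /merged_ideal var_subst_id //.
  suff -> : (fun s => mnm_subst id (m s)) = m by [].
  by apply/funext => s; apply/mnmP => l; rewrite mnmE (big_pred1 l).
exists 1; rewrite ideal_adjsP => -[q]; rewrite (ideal_gen_monomial GE) => /(_ 0%MM).
rewrite mcoeff_msupp mcoeffB mcoeff1 eqxx raddf_sum big1 => [|j _]; last first.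
  by rewrite /= rmorphM /= (max_idealP _).1 ?mul0r //; apply/fm/mem_nth.
rewrite subr0 oner_eq0 => /(_ isT) [s] /mnm_lepP ms.
case/eqP: (m0 s); apply/mnmP => i; rewrite mnm0E; apply/eqP.
by have := ms i; rewrite mnm0E leqn0.
Qed.
End DepthLowerBound.

(** * Minimal resolutions and projective dimension *)

Section LinearLifting.
Variable R : comNzRingType.

Lemma linear_pack (U V : lmodType R) (f : U -> V) :
  linear f -> exists g : {linear U -> V}, g =1 f.
Proof.
move=> lf; pose aL := GRing.isLinear.Build R U V _ f lf.
pose g : {linear U -> V} := HB.pack f aL.
by exists g.
Qed.

Definition ker_pred (A B : lmodType R) (g : {linear A -> B}) : {pred A} :=
  fun a => g a == 0.

Lemma ker_pred_closed (A B : lmodType R) (g : {linear A -> B}) : submod_closed (ker_pred g).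
Proof.
split; first by rewrite unfold_in raddf0.
by move=> a u v /eqP gu /eqP gv; rewrite unfold_in linearP gu gv scaler0 addr0.
Qed.

HB.instance Definition _ (A B : lmodType R) (g : {linear A -> B}) :=
  GRing.isSubmodClosed.Build R A (ker_pred g) (ker_pred_closed g).

(** Projectivity lifts along surjections only, while g need only reach the image of f; the lift is
    taken along A -> A / ker g instead. *)
Lemma projective_lift (P A B : lmodType R) (g : {linear A -> B}) (f : {linear P -> B}) :
    projective P -> (forall p, exists a, g a = f p) ->
  exists h : {linear P -> A}, forall p, g (h p) = f p.
Proof.
move=> projP gf; have [a gaf] := choice gf.
have [|f' f'E] := @linear_pack P (quotmod (ker_pred g)) (fun p => proj_quotmod (ker_pred g) (a p)).
  move=> c p q; rewrite -linearP; apply/proj_quotmod_eq.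
  by rewrite unfold_in raddfB /= linearP !gaf linearP subrr.
have [|h hE] := projP _ _ (proj_quotmod (ker_pred g) : {linear A -> quotmod (ker_pred g)}) f'.
  by move=> b; exists (repr (b : Quotient.quot (submod_pred (ker_pred g)))); exact: repr_quotmodK.
exists h => p; have := hE p; rewrite f'E => /proj_quotmod_eq.
by rewrite unfold_in raddfB /= gaf subr_eq0 => /eqP.
Qed.

Lemma projective_free r : projective 'rV[R]_r.
Proof.
move=> A B g f surj_g.
have [a ga] := choice (fun i => surj_g (f (delta_mx 0 i : 'rV[R]_r))).
have [|h hE] := @linear_pack 'rV[R]_r A (fun v => \sum_i v 0 i *: a i).
  move=> c u v; rewrite scaler_sumr -big_split; apply: eq_bigr => i _.
  by rewrite !mxE scalerDl scalerA.
exists h => v; rewrite hE [in RHS](row_sum_delta v) !raddf_sum.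
by apply: eq_bigr => i _; rewrite /= !linearZ ga.
Qed.

End LinearLifting.

(** * Comparing a minimal resolution with projective ones *)

Section MinimalResolution.
Variables (k : fieldType) (N : nat).
Local Notation S := {mpoly k[N]}.
Variables (M : lmodType S) (gr : nat -> M -> Prop) (F : min_graded_resolution gr).

Let aug_surj y : exists v, aug F v = y.
Proof. by case: F. Qed.

Let aug_exact : forall v, aug F v = 0 <-> exists w, v = w *m dif F 0.
Proof. by case: F. Qed.

Let dif_exact : forall i (v : 'rV_(rk F i.+1)),
  v *m dif F i = 0 <-> exists w, v = w *m dif F i.+1.
Proof. by case: F. Qed.

Let dif_max : forall i r c, max_ideal (dif F i r c).
Proof. by case: F. Qed.

Definition free_resolution : proj_resolution M :=
  @ProjResolution S M (fun i => 'rV[S]_(rk F i)) (fun i => mulmxr (dif F i)) (aug F)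
    (fun i => @projective_free S _) aug_surj aug_exact dif_exact.

Lemma max_ideal_ideal : is_ideal (@max_ideal k N).
Proof. exact: ideal_gen_ideal. Qed.

(* Comparing with a projective resolution P, the composite F -> P -> F is homotopic  *)
(* to the identity, and the homotopy contributes only entries in the maximal ideal.  *)
Lemma comparison (P : proj_resolution M) i :
  exists (al : {linear 'rV[S]_(rk F i) -> P i}) (be : {linear P i -> 'rV[S]_(rk F i)})
         (h : {linear 'rV[S]_(rk F i) -> 'rV[S]_(rk F i.+1)}),
    [/\ forall x, exists z, al (x *m dif F i) = pres_dif P i z,
        forall z, exists x, be (pres_dif P i z) = x *m dif F i,
        forall x, be (al (x *m dif F i)) - x *m dif F i - h (x *m dif F i) *m dif F i = 0
      & forall x c, max_ideal ((be (al x) - x - h x *m dif F i) 0 c)].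
Proof.
have [m0 mD mM] := max_ideal_ideal.
case: P => P dP aP projP aP_surj aP_exact dP_exact /=.
have dd j (x : 'rV[S]_(rk F j.+2)) : x *m dif F j.+1 *m dif F j = 0 by apply/dif_exact; exists x.
have ddP j x : dP j (dP j.+1 x) = 0 by apply/dP_exact; exists x.
elim: i => [|i [al [be [h [alF beF hF hm]]]]].
  have [al alE] := projective_lift (@projective_free S _)
    (fun p => aP_surj (aug F p)).
  have [be beE] := projective_lift (projP 0%N) (fun p => aug_surj (aP p)).
  pose h0 : {linear 'rV[S]_(rk F 0) -> 'rV[S]_(rk F 0)} := (be \o al) \- idfun.
  have h0E x : h0 x = be (al x) - x by [].
  have [|h hE] := @projective_lift _ _ _ _ (mulmxr (dif F 0)) h0 (@projective_free S _).
    move=> p /=; have [|w wE] := (aug_exact (h0 p)).1; last by exists w.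
    by rewrite h0E raddfB /= beE alE subrr.
  exists al, be, h; split=> [x|z|x|x c].
  - by apply/aP_exact; rewrite alE; apply/aug_exact; exists x.
  - by apply/aug_exact; rewrite beE; apply/aP_exact; exists z.
  - by have /= -> := hE (x *m dif F 0); rewrite subrr.
  - by have /= -> := hE x; rewrite subrr mxE.
have [|al' al'E] := @projective_lift _ _ _ _ (dP i)
    (al \o mulmxr (dif F i)) (@projective_free S _).
  by move=> x /=; have [z ->] := alF x; exists z.
have [|be' be'E] := @projective_lift _ _ _ _ (mulmxr (dif F i)) (be \o dP i) (projP i.+1).
  by move=> z /=; have [x ->] := beF z; exists x.
rewrite /= in al'E be'E.
pose h0 : {linear 'rV[S]_(rk F i.+1) -> 'rV[S]_(rk F i.+1)} :=
  ((be' \o al') \- idfun) \- (h \o mulmxr (dif F i)).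
have h0E x : h0 x = be' (al' x) - x - h (x *m dif F i) by [].
have [|h' h'E] := @projective_lift _ _ _ _ (mulmxr (dif F i.+1)) h0 (@projective_free S _).
  move=> x /=; have [|w wE] := (dif_exact (h0 x)).1; last by exists w.
  by rewrite h0E !mulmxBl be'E al'E hF.
rewrite /= in h'E.
exists al', be', h'; split=> [x|z|x|x c].
- by apply/dP_exact; rewrite al'E /= dd raddf0.
- by apply/dif_exact; rewrite be'E /= ddP raddf0.
- by rewrite h'E opprB addrC subrK dd raddf0.
rewrite h'E opprB addrC subrK.
(* What remains is h applied to x *m dif F i, whose coordinates lie in the maximal ideal by
   minimality. *)
rewrite [x *m _]row_sum_delta raddf_sum summxE; apply: (big_ind (@max_ideal k N)) => // j _.
rewrite /= linearZ !mxE mulrC; apply: (mM); apply: (big_ind (@max_ideal k N)) => // l _.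
by apply: mM; apply: dif_max.
Qed.

(** If P d = 0, the composite through P vanishes in [comparison], so a basis vector of F d would
    have its coordinate 1 in the maximal ideal. *)
Lemma min_resolution_pd d :
  (0 < rk F d)%N -> (forall i, (d < i)%N -> rk F i = 0%N) -> is_pd M d.
Proof.
move=> rkd rk0; split.
  exists free_resolution => i /rk0 /= rki x; apply/rowP => c.
  by have := ltn_ord c; rewrite [X in (_ < X)%N]rki.
move=> e [P P0]; rewrite leqNgt; apply/negP => ed.
have [al [be [h [_ _ _ hm]]]] := comparison P d.
pose c := Ordinal rkd; have := hm (delta_mx 0 c) c.
rewrite (P0 d ed (al _)) raddf0 sub0r => /max_idealP.
rewrite !mxE !eqxx mcoeffB mcoeffN mcoeff1 eqxx raddf_sum big1 => [|j _]; last first.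
  by rewrite /= rmorphM /= (max_idealP (dif F d j c)).1 ?mulr0.
by rewrite subr0 => /eqP; rewrite oppr_eq0 oner_eq0.
Qed.

Lemma min_resolution_reg r :
    (forall i (c : 'I_(rk F i)), deg c <= i + r)%N ->
    (exists i (c : 'I_(rk F i)), deg c = i + r)%N ->
  is_reg gr r.
Proof.
move=> le_r [i0 [c0 dc0]]; exists F; split.
  move=> i j /eqP; rewrite -lt0n card_gt0 => /set0Pn [c].
  by rewrite inE => /eqP <-.
exists i0, (i0 + r)%N; split=> //; apply/eqP; rewrite -lt0n card_gt0.
by apply/set0Pn; exists c0; rewrite inE dc0.
Qed.

End MinimalResolution.

(** * The Taylor resolution *)

Section TaylorResolution.
Variables (k : fieldType) (N n : nat) (m : 'I_n -> 'X_{1..N}).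
Local Notation S := {mpoly k[N]}.
Variable G : S -> Prop.
Implicit Types (A B : {set 'I_n}).
Hypothesis GE : forall p, G p <-> exists i, p = 'X_[m i].
Hypothesis lcm_min : forall j (B : {set 'I_n}), j \notin B -> lcm_mnm m (j |: B) != lcm_mnm m B.

Definition face i : finType := {A : {set 'I_n} | #|A| == i}.
Local Notation rank i := #|{: face i}|.

Definition face_of i (c : 'I_(rank i)) : {set 'I_n} := val (enum_val c).

Lemma card_face_of i (c : 'I_(rank i)) : #|face_of c| = i.
Proof. exact/eqP/(valP (enum_val c)). Qed.

(** Row vectors indexed by an enumeration of the i-element sets become functions on all sets, zero
    elsewhere, to which the Taylor lemmas apply. *)
Definition chain_of i (v : 'rV[S]_(rank i)) : {set 'I_n} -> S :=
  fun A => if insub A is Some e then v 0 (enum_rank (e : face i)) else 0.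

Lemma chain_of_face i (v : 'rV[S]_(rank i)) c : chain_of v (face_of c) = v 0 c.
Proof. by rewrite /chain_of /face_of valK enum_valK. Qed.

Lemma chain_of_card i (v : 'rV[S]_(rank i)) A : #|A| != i -> chain_of v A = 0.
Proof. by move=> Ai; rewrite /chain_of insubF //; apply/negbTE. Qed.

Lemma face_ofP i (A : {set 'I_n}) : #|A| = i -> exists c : 'I_(rank i), A = face_of c.
Proof.
move=> /eqP Ai; exists (enum_rank (Sub A Ai : face i)).
by rewrite /face_of enum_rankK.
Qed.

Lemma chain_of_inj i (v w : 'rV[S]_(rank i)) : chain_of v =1 chain_of w -> v = w.
Proof. by move=> vw; apply/rowP => c; rewrite -!chain_of_face. Qed.

Lemma chain_of_row i (w : {set 'I_n} -> S) :
  (forall A, #|A| != i -> w A = 0) -> chain_of (\row_c w (face_of (c : 'I_(rank i)))) =1 w.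
Proof.
move=> w0 A; have [/face_ofP [c ->]|Ai] := eqVneq #|A| i.
  by rewrite chain_of_face mxE.
by rewrite chain_of_card ?w0.
Qed.

Lemma chain_of_linear i A a (u v : 'rV[S]_(rank i)) :
  chain_of (a *: u + v) A = a * chain_of u A + chain_of v A.
Proof.
have [/face_ofP [c ->]|Ai] := eqVneq #|A| i.
  by rewrite !chain_of_face !mxE.
by rewrite !chain_of_card // mulr0 addr0.
Qed.

Definition taylor_mx i : 'M[S]_(rank i.+1, rank i) :=
  \matrix_(r, c) \sum_(j | (j \notin face_of c) && (j |: face_of c == face_of r))
    taylor_sign k j (face_of c) *: 'X_[lcm_mnm m (face_of r) - lcm_mnm m (face_of c)].

Lemma chain_of_taylor_mx i (v : 'rV_(rank i.+1)) B :
  chain_of (v *m taylor_mx i) B = taylor_dif m (chain_of v) B.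
Proof.
have [/face_ofP [c ->]|Bi] := eqVneq #|B| i; last first.
  rewrite chain_of_card // /taylor_dif big1 // => j jB.
  by rewrite chain_of_card ?mul0r ?scaler0 // cardsU1 jB.
rewrite chain_of_face mxE; under eq_bigr => r _ do rewrite mxE mulr_sumr big_mkcondr.
rewrite exchange_big; apply: eq_bigr => j jc /=.
have [|r rE] := @face_ofP i.+1 (j |: face_of c); first by rewrite cardsU1 jc card_face_of.
rewrite rE (bigD1 r) //= eqxx big1 ?addr0 => [|s sr].
  by rewrite chain_of_face scalerAr.
case: eqP => // /val_inj /enum_val_inj rs; by rewrite rs eqxx in sr.
Qed.

Definition taylor_aug (v : 'rV[S]_(rank 0)) : quot_ideal G := quot_ideal_pi G (chain_of v set0).

Lemma taylor_aug_linear : linear taylor_aug.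
Proof.
move=> a u v; rewrite /taylor_aug chain_of_linear.
exact: (proj_quotmod_is_linear (ideal_pred G)).
Qed.

HB.instance Definition _ := GRing.isLinear.Build S 'rV[S]_(rank 0) (quot_ideal G) _
  taylor_aug taylor_aug_linear.

Definition taylor_deg i (c : 'I_(rank i)) := mdeg (lcm_mnm m (face_of c)).

Lemma taylor_gr (c : 'I_(rank 0)) : quot_gr (taylor_deg c) (taylor_aug (delta_mx 0 c)).
Proof.
have c0 : face_of c = set0 by apply/eqP; rewrite -cards_eq0 card_face_of.
exists 1; rewrite /taylor_deg c0 lcm_mnm0 mdeg0 dhomog1; split=> //.
by rewrite /taylor_aug -c0 chain_of_face mxE !eqxx.
Qed.

Lemma taylor_homog i (r : 'I_(rank i.+1)) (c : 'I_(rank i)) :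
  ((taylor_deg c <= taylor_deg r)%N -> taylor_mx i r c \is (taylor_deg r - taylor_deg c)%N.-homog) /\
  ((taylor_deg r < taylor_deg c)%N -> taylor_mx i r c = 0).
Proof.
have cr j : j |: face_of c == face_of r -> (lcm_mnm m (face_of c) <= lcm_mnm m (face_of r))%MM.
  by move=> /eqP <-; apply/lcm_mnm_subset/subsetUr.
split=> [_|]; rewrite mxE.
  apply: rpred_sum => j /andP[_ /cr le_cr]; rewrite rpredZ // dhomogX.
  by rewrite /taylor_deg -[in X in _ == X](submK le_cr) mdegD addnK.
move=> lt_rc; rewrite big1 // => j /andP[_ /cr le_cr]; move: lt_rc.
by rewrite /taylor_deg -(submK le_cr) mdegD; lia.
Qed.

Lemma taylor_aug_surj y : exists v, taylor_aug v = y.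
Proof.
have [p ->] := quot_ideal_piP y.
exists (\row_c (if face_of (c : 'I_(rank 0)) == set0 then p else 0)).
rewrite /taylor_aug (@chain_of_row 0 (fun A => if A == set0 then p else 0)) ?eqxx // => A.
by rewrite cards_eq0 => /negbTE ->.
Qed.

Lemma taylor_aug_exact v : taylor_aug v = 0 <-> exists w, v = w *m taylor_mx 0.
Proof.
have -> : taylor_aug v = 0 <-> monomial_ideal m (chain_of v set0).
  have <- : quot_ideal_pi G 0 = 0 by apply: (raddf0 (proj_quotmod (ideal_pred G))).
  by rewrite quot_ideal_pi_eq subr0; apply: ideal_gen_monomial.
rewrite monomial_ideal_sum; split=> [[q qE]|[w ->]]; last first.
  exists (fun j => chain_of w [set j]).
  by rewrite chain_of_taylor_mx taylor_dif_set0.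
pose w A := \sum_(s | A == [set s]) q s.
exists (\row_c w (face_of (c : 'I_(rank 1)))); apply: chain_of_inj => B.
have w0 A : #|A| != 1%N -> w A = 0.
  by move=> A1; rewrite /w big_pred0 // => s; apply: contraNF A1 => /eqP ->; rewrite cards1.
rewrite chain_of_taylor_mx; have [->|B0] := eqVneq B set0; last first.
  rewrite chain_of_card ?cards_eq0 // /taylor_dif big1 // => j jB.
  rewrite chain_of_card ?mul0r ?scaler0 // cardsU1 jB.
  by rewrite add1n eqSS cards_eq0.
rewrite qE taylor_dif_set0; apply: eq_bigr => j _; rewrite chain_of_row // /w.
by rewrite (big_pred1 j) // => t /=; rewrite (inj_eq set1_inj) eq_sym.
Qed.

Lemma taylor_mx_exact i (v : 'rV_(rank i.+1)) :
  v *m taylor_mx i = 0 <-> exists w, v = w *m taylor_mx i.+1.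
Proof.
split=> [v0|[w ->]]; last first.
  apply: chain_of_inj => B; rewrite chain_of_taylor_mx.
  have -> : chain_of (w *m taylor_mx i.+1) = taylor_dif m (chain_of w).
    by apply/funext => A; rewrite chain_of_taylor_mx.
  by rewrite taylor_dif_dif /chain_of; case: insub => // e; rewrite mxE.
have [|w [vw w_supp]] := @taylor_exact _ _ _ m (chain_of v).
  move=> B; rewrite -chain_of_taylor_mx v0 /chain_of.
  by case: insub => // e; rewrite mxE.
(* The support clause of [taylor_exact] confines the preimage to sets with one element more. *)
have w0 A : #|A| != i.+2 -> w A = 0.
  apply: contraNeq => /w_supp [a aA]; apply: contraNeq => Ai; rewrite chain_of_card //.
  by apply: contraNneq Ai => <-; rewrite (cardsD1 a A) aA /= add1n eqxx.
exists (\row_c w (face_of (c : 'I_(rank i.+2)))); apply: chain_of_inj => B.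
have [Bi|Bi] := eqVneq #|B| i.+1; last by rewrite !chain_of_card.
rewrite chain_of_taylor_mx vw -?cards_eq0 ?Bi //.
by congr (taylor_dif m _ B); apply/funext => A; rewrite chain_of_row.
Qed.

Lemma taylor_mx_max i r c : max_ideal (taylor_mx i r c).
Proof.
rewrite mxE; have [I0 ID IM] := max_ideal_ideal k N.
apply: (big_ind (@max_ideal k N)) => // j /andP[jc /eqP jr].
apply/max_idealP; rewrite mcoeffZ mcoeffX.
have le_cr : (lcm_mnm m (face_of c) <= lcm_mnm m (face_of r))%MM.
  by rewrite -jr; apply/lcm_mnm_subset/subsetUr.
case: eqP => [e|_]; last by rewrite mulr0.
have := lcm_min jc; rewrite jr -(submK le_cr) e.
by rewrite add0m eqxx.
Qed.

Definition taylor_resolution : min_graded_resolution (quot_gr (G := G)) :=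
  @MinGradedResolution k N (quot_ideal G) (quot_gr (G := G)) (fun i => rank i)
    taylor_deg taylor_mx taylor_aug taylor_gr taylor_homog
    taylor_aug_surj taylor_aug_exact taylor_mx_exact taylor_mx_max.

Lemma taylor_pd : is_pd (quot_ideal G) n.
Proof.
apply: (min_resolution_pd (F := taylor_resolution)) => [|i ni] /=.
  by have [|c _] := @face_ofP n setT; rewrite ?cardsT ?card_ord //; case: c => c; case: (rank n).
apply/eqP; rewrite -leqn0 leqNgt; apply/negP => ri.
have := max_card (face_of (Ordinal ri)).
by rewrite card_face_of card_ord leqNgt ni.
Qed.

Lemma taylor_reg r : (forall A, mdeg (lcm_mnm m A) <= #|A| + r)%N ->
    (exists A, mdeg (lcm_mnm m A) = #|A| + r)%N ->
  is_reg (quot_gr (G := G)) r.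
Proof.
move=> le_r [A rA]; apply: (min_resolution_reg (F := taylor_resolution)).
  by move=> i c /=; rewrite /taylor_deg -[in leqRHS](card_face_of c).
by exists #|A|; have [c AE] := face_ofP (erefl #|A|); exists c; rewrite /= /taylor_deg -AE.
Qed.

End TaylorResolution.

(** * Resolution by consecutive syzygies *)

Lemma mpolyX_neq0 (R : nzRingType) N (d : 'X_{1..N}) : 'X_[R, d] != 0.
Proof. by apply/eqP => /(congr1 (mcoeff d))/eqP; rewrite mcoeffX eqxx mcoeff0 oner_eq0. Qed.

(* When m j divides lcm (m s, m t) for s <= j <= t, the syzygy between m s and m t         *)
(* telescopes into syzygies between neighbours.                                            *)
Section ConsecutiveResolution.
Variables (k : fieldType) (N n : nat) (m : 'I_n.+1 -> 'X_{1..N}).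
Local Notation S := {mpoly k[N]}.
Variable G : S -> Prop.
Hypothesis GE : forall p, G p <-> exists i, p = 'X_[m i].
Hypothesis m_lcm : forall s j t : 'I_n.+1, (s <= j <= t)%N -> (m j <= mlcm (m s) (m t))%MM.
Hypothesis m_neq0 : forall s, m s != 0%MM.

Definition nbr_lcm (j : 'I_n) : 'X_{1..N} :=
  mlcm (m (widen_ord (leqnSn n) j)) (m (lift ord0 j)).

Hypothesis nbr_lcm_neq : forall (j : 'I_n) (c : 'I_n.+1), (c == j :> nat) || (c == j.+1 :> nat) ->
  nbr_lcm j != m c.

Lemma nbr_lcm_ge (j : 'I_n) (c : 'I_n.+1) : (c == j :> nat) || (c == j.+1 :> nat) ->
  (m c <= nbr_lcm j)%MM.
Proof.
rewrite /nbr_lcm => /orP[/eqP cj|/eqP cj].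
  by rewrite (_ : c = widen_ord (leqnSn n) j) ?lem_mlcml //; apply: val_inj.
by rewrite (_ : c = lift ord0 j) ?lem_mlcmr //; apply: val_inj; rewrite /= /bump.
Qed.

Definition nbr_rank i := match i with 0 => 1%N | 1 => n.+1 | 2 => n | _ => 0%N end.

Definition nbr_deg i : 'I_(nbr_rank i) -> nat :=
  match i with
  | 0 => fun=> 0%N
  | 1 => fun c => mdeg (m c)
  | 2 => fun c => mdeg (nbr_lcm c)
  | _ => fun=> 0%N
  end.

Definition gen_mx : 'M[S]_(n.+1, 1) := \matrix_(r, c) 'X_[m r].

Definition nbr_mx : 'M[S]_(n, n.+1) := \matrix_(j, c)
  if c == j :> nat then 'X_[nbr_lcm j - m c]
  else if c == j.+1 :> nat then - 'X_[nbr_lcm j - m c] else 0.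

Definition nbr_dif i : 'M[S]_(nbr_rank i.+1, nbr_rank i) :=
  match i with 0 => gen_mx | 1 => nbr_mx | _ => 0 end.

Lemma row_nbr_mx (j : 'I_n) : row j nbr_mx =
  'X_[nbr_lcm j - m (widen_ord (leqnSn n) j)] *: delta_mx 0 (widen_ord (leqnSn n) j)
  - 'X_[nbr_lcm j - m (lift ord0 j)] *: delta_mx 0 (lift ord0 j).
Proof.
apply/rowP => c; rewrite !mxE /= -!val_eqE /= /bump leq0n add1n.
case: eqVneq => [cj|cj].
  rewrite (_ : c = widen_ord (leqnSn n) j) ?mulr1 /=; last exact: val_inj.
  by rewrite (ltn_eqF (ltnSn _)) mulr0 subr0.
rewrite mulr0 sub0r; case: eqVneq => [cj'|_]; last by rewrite mulr0 oppr0.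
by rewrite mulr1 (_ : c = lift ord0 j) //; apply: val_inj; rewrite /= /bump.
Qed.

Lemma nbr_gen_mx : nbr_mx *m gen_mx = 0.
Proof.
apply/row_matrixP => j; rewrite row_mul row_nbr_mx row0 mulmxBl -!scalemxAl -!rowE.
apply/rowP => c; rewrite !mxE -!mpolyXD !submK ?subrr //; apply: nbr_lcm_ge.
  by rewrite eqxx orbT.
by rewrite eqxx.
Qed.

(** The common multiple D stays fixed during the induction on t, whereas the lcm of m s and m t
    would change with t. *)
Lemma nbr_telescope D (s t : 'I_n.+1) :
    (s <= t)%N -> (forall j : 'I_n.+1, (s <= j <= t)%N -> (m j <= D)%MM) ->
  exists w, 'X_[D - m s] *: (delta_mx 0 s : 'rV_n.+1) - 'X_[D - m t] *: delta_mx 0 t = w *m nbr_mx.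
Proof.
case: t => t; elim: t => [|t IH] lt_t st mD.
  exists 0; rewrite mul0mx (_ : s = Ordinal lt_t) ?subrr //.
  by apply: val_inj; move: st; rewrite /= leqn0 => /eqP.
have [es|ns] := eqVneq (s : nat) t.+1.
  by exists 0; rewrite mul0mx (_ : s = Ordinal lt_t) ?subrr //; apply: val_inj.
have lt_t' : (t < n.+1)%N by apply: ltn_trans (lt_t).
have st' : (s <= t)%N by move: st ns => /=; lia.
have [|j sj|w wE] := IH lt_t' => //.
  by apply: mD; move: sj => /=; lia.
pose j := Ordinal (lt_t : (t < n)%N).
have jt : widen_ord (leqnSn n) j = Ordinal lt_t' by apply: val_inj.
have jt1 : lift ord0 j = Ordinal lt_t by apply: val_inj.
have jD : (nbr_lcm j <= D)%MM.
  by rewrite /nbr_lcm lem_mlcm jt jt1 !mD //=; move: st; rewrite /=; lia.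
exists (w + 'X_[D - nbr_lcm j] *: delta_mx 0 j).
rewrite mulmxDl -wE -scalemxAl -rowE row_nbr_mx jt jt1.
rewrite scalerBr !scalerA -!mpolyXD.
have DE (c : 'I_n.+1) : (m c <= nbr_lcm j)%MM -> (D - nbr_lcm j + (nbr_lcm j - m c) = D - m c)%MM.
  move=> /mnm_lepP le_c; apply/mnmP => i; rewrite mnmDE !mnmBE.
  by have := le_c i; move/mnm_lepP: jD => /(_ i); lia.
by rewrite !DE ?subrKA //; apply: nbr_lcm_ge; rewrite /= eqxx ?orbT.
Qed.

Lemma nbr_gen_exact (v : 'rV_n.+1) : v *m gen_mx = 0 <-> exists w, v = w *m nbr_mx.
Proof.
split=> [v0|[w ->]]; last by rewrite -mulmxA nbr_gen_mx mulmx0.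
have /monomial_syzygy [r rE] : \sum_(s < n.+1) v 0 s * 'X_[m s] = 0.
  by have /(congr1 (fun A : 'rV_1 => A 0 0)) := v0; rewrite !mxE => v00; rewrite -[RHS]v00;
     apply: eq_bigr => s _; rewrite mxE.
pose im (u : 'rV[S]_n.+1) := exists w, u = w *m nbr_mx.
have im0 : im 0 by exists 0; rewrite mul0mx.
have imD u u' : im u -> im u' -> im (u + u').
  by move=> [w ->] [w' ->]; exists (w + w'); rewrite mulmxDl.
have imZ a u : im u -> im (a *: u) by move=> [w ->]; exists (a *: w); rewrite scalemxAl.
pose e s t : 'rV[S]_n.+1 := 'X_[mlcm (m s) (m t) - m s] *: delta_mx 0 s.
have im_e s t : im (e s t - e t s).
  wlog st : s t / (s <= t)%N => [H|].
    have [/H//|/ltnW/H] := leqP s t; rewrite -opprB => /(imZ (- 1)).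
    by rewrite scaleN1r ?opprK.
  have [|w wE] := @nbr_telescope (mlcm (m s) (m t)) s t st.
    by move=> j; apply: m_lcm.
  by exists w; rewrite -wE /e [mlcm (m t) _]mlcmC.
suff -> : v = \sum_s \sum_t r s t *: (e s t - e t s).
  by apply: (big_ind im) => // s _; apply: (big_ind im) => // t _; apply: imZ.
have -> : \sum_s \sum_t r s t *: (e s t - e t s) = \sum_s \sum_t (r s t - r t s) *: e s t.
  under eq_bigr => s _ do (under eq_bigr => t _ do rewrite scalerBr; rewrite sumrB).
  rewrite sumrB [X in _ - X]exchange_big -sumrB; apply: eq_bigr => s _.
  by rewrite -sumrB; apply: eq_bigr => t _; rewrite scalerBl.
rewrite [LHS]row_sum_delta; apply: eq_bigr => s _; rewrite rE scaler_suml.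
by apply: eq_bigr => t _; rewrite scalerA.
Qed.

(** The matrix is bidiagonal: column c involves only the entries c and c - 1 of w, so these vanish
    in turn from the first on. *)
Lemma nbr_mx_inj (w : 'rV_n) : w *m nbr_mx = 0 -> w = 0.
Proof.
move=> w0; apply/rowP => -[c lt_c]; rewrite mxE.
elim/ltn_ind: c lt_c => c IH lt_c.
pose c' := widen_ord (leqnSn n) (Ordinal lt_c).
have /(congr1 (fun A : 'rV_n.+1 => A 0 c')) := w0.
rewrite !mxE (bigD1 (Ordinal lt_c)) //= mxE /= eqxx big1 ?addr0 => [/eqP|[j lt_j] /= jc].
  by rewrite mulf_eq0 (negbTE (mpolyX_neq0 _ _)) orbF => /eqP.
rewrite mxE /=; case: eqP => [e|_]; first by case/eqP: jc; apply: val_inj.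
case: eqP => [e|_]; last by rewrite mulr0.
by rewrite IH ?mul0r // e.
Qed.

Definition nbr_aug (v : 'rV[S]_1) : quot_ideal G := quot_ideal_pi G (v 0 0).

Lemma nbr_aug_linear : linear nbr_aug.
Proof.
move=> a u v; rewrite /nbr_aug !mxE.
exact: (proj_quotmod_is_linear (ideal_pred G)).
Qed.

HB.instance Definition _ := GRing.isLinear.Build S 'rV[S]_1 (quot_ideal G) _
  nbr_aug nbr_aug_linear.

Lemma nbr_gr (c : 'I_(nbr_rank 0)) : quot_gr (nbr_deg c) (nbr_aug (delta_mx 0 c)).
Proof.
exists 1; rewrite dhomog1; split=> //.
by rewrite /nbr_aug mxE [c]ord1 eqxx.
Qed.

Lemma nbr_homog i (r : 'I_(nbr_rank i.+1)) (c : 'I_(nbr_rank i)) :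
  ((nbr_deg c <= nbr_deg r)%N -> nbr_dif i r c \is (nbr_deg r - nbr_deg c)%N.-homog) /\
  ((nbr_deg r < nbr_deg c)%N -> nbr_dif i r c = 0).
Proof.
case: i r c => [|[|i]] r c /=.
- by split=> // _; rewrite mxE dhomogX subn0 /=.
- have degE : (m c <= nbr_lcm r)%MM ->
      mdeg (nbr_lcm r - m c) = (mdeg (nbr_lcm r) - mdeg (m c))%N.
    by move=> /submK {2}<-; rewrite mdegD addnK.
  rewrite mxE; case: (boolP (_ == _)) => [cr|_].
    have le_c : (m c <= nbr_lcm r)%MM by apply: nbr_lcm_ge; rewrite cr.
    split=> [_|]; first by rewrite dhomogX /= degE.
    by rewrite -(submK le_c) mdegD; lia.
  case: (boolP (_ == _)) => [cr|_]; last by split=> // _; apply: dhomog0.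
  have le_c : (m c <= nbr_lcm r)%MM by apply: nbr_lcm_ge; rewrite cr orbT.
  split=> [_|]; first by rewrite dhomogN dhomogX /= degE.
  by rewrite -(submK le_c) mdegD; lia.
- by case: r.
Qed.

Lemma nbr_aug_surj y : exists v, nbr_aug v = y.
Proof.
by have [p ->] := quot_ideal_piP y; exists (const_mx p); rewrite /nbr_aug mxE.
Qed.

Lemma nbr_aug_exact v : nbr_aug v = 0 <-> exists w, v = w *m nbr_dif 0.
Proof.
have -> : nbr_aug v = 0 <-> monomial_ideal m (v 0 0).
  have <- : quot_ideal_pi G 0 = 0 by apply: (raddf0 (proj_quotmod (ideal_pred G))).
  by rewrite quot_ideal_pi_eq subr0; apply: ideal_gen_monomial.
rewrite monomial_ideal_sum; split=> [[q qE]|[w ->]].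
  exists (\row_s q s); apply/rowP => c; rewrite [c]ord1 qE mxE.
  by apply: eq_bigr => s _; rewrite !mxE.
by exists (fun s => w 0 s); rewrite mxE; apply: eq_bigr => s _; rewrite mxE.
Qed.

Lemma nbr_dif_exact i (v : 'rV_(nbr_rank i.+1)) :
  v *m nbr_dif i = 0 <-> exists w, v = w *m nbr_dif i.+1.
Proof.
case: i v => [|[|i]] v; first exact: nbr_gen_exact.
- split=> [/nbr_mx_inj ->|[w ->]]; first by exists 0; rewrite mul0mx.
  by rewrite mulmx0 mul0mx.
- by split=> _; [exists 0 | rewrite mulmx0]; apply/rowP => -[].
Qed.

Lemma nbr_dif_max i r c : max_ideal (nbr_dif i r c).
Proof.
case: i r c => [|[|i]] r c; apply/max_idealP => /=; last by rewrite mxE mcoeff0.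
  by rewrite mxE mcoeffX (negbTE (m_neq0 _)).
have lcm0 : (c == r :> nat) || (c == r.+1 :> nat) -> 'X_[k, nbr_lcm r - m c]@_0%MM = 0.
  move=> cr; rewrite mcoeffX; case: eqP => // e.
  by have := nbr_lcm_neq cr; rewrite -(submK (nbr_lcm_ge cr)) e add0m eqxx.
rewrite mxE; case: (boolP (_ == _)) => [cr|_]; first by rewrite lcm0 ?cr.
case: (boolP (_ == _)) => [cr|_]; last by rewrite mcoeff0.
by rewrite mcoeffN lcm0 ?oppr0 // cr orbT.
Qed.

Definition nbr_resolution : min_graded_resolution (quot_gr (G := G)) :=
  @MinGradedResolution k N (quot_ideal G) (quot_gr (G := G)) nbr_rank
    nbr_deg nbr_dif nbr_aug nbr_gr nbr_homog
    nbr_aug_surj nbr_aug_exact nbr_dif_exact nbr_dif_max.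

Lemma nbr_pd : (0 < n)%N -> is_pd (quot_ideal G) 2.
Proof. by move=> n0; apply: (min_resolution_pd (F := nbr_resolution)) => // -[|[|[]]]. Qed.

Lemma nbr_reg r : (forall s, mdeg (m s) = r.+1) -> (forall j, mdeg (nbr_lcm j) = r.+2) ->
  is_reg (quot_gr (G := G)) r.
Proof.
move=> deg1 deg2; apply: (min_resolution_reg (F := nbr_resolution)).
  by move=> [|[|[|i]]] c //=; rewrite ?deg1 ?deg2.
by exists 1%N, ord0; rewrite /= deg1.
Qed.

End ConsecutiveResolution.

(** * Maximal chains of L2 n *)

Local Close Scope ring_scope.

Section MaximalChains.
Variable n : nat.
Local Notation L := (L2 n.+1).
Implicit Types (u v : L) (s : seq L) (t : 'I_n.+1).

Definition row_of u : nat := u.1.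
Definition pos_of u : nat := u.2.
Definition L2_at (i a : nat) : L := (inord i, inord a).
Definition L2_rank u : nat := row_of u + pos_of u.

Lemma L2_bound u : (row_of u < 2)%N /\ (pos_of u < n.+1)%N.
Proof. by split; apply: ltn_ord. Qed.

Lemma row_at i a : (i < 2)%N -> row_of (L2_at i a) = i.
Proof. exact: inordK. Qed.

Lemma pos_at i a : (a < n.+1)%N -> pos_of (L2_at i a) = a.
Proof. exact: inordK. Qed.

Lemma L2P u v : row_of u = row_of v -> pos_of u = pos_of v -> u = v.
Proof. by case: u v => [i a] [j b] /val_inj /= -> /val_inj /= ->. Qed.

Lemma coveredE u v : covered u v =
  ((row_of u == row_of v) && (pos_of v == (pos_of u).+1))
  || [&& row_of u == 0, row_of v == 1 & pos_of u == pos_of v]%N.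
Proof. exact: covered_L2. Qed.

Lemma covered_rank u v : covered u v -> L2_rank v = (L2_rank u).+1.
Proof. by rewrite coveredE /L2_rank; lia. Qed.

(* The maximal chain that leaves the bottom row at position t. *)
Definition chain_at t : seq L :=
  mkseq (fun i => if (i <= t)%N then L2_at 0 i else L2_at 1 i.-1) n.+2.

Definition on_chain t v : bool :=
  if row_of v == 0%N then (pos_of v <= t)%N else (t <= pos_of v)%N.

Lemma mem_chain_at t v : (v \in chain_at t) = on_chain t v.
Proof.
have [v1 v2] := L2_bound v; have lt := ltn_ord t; rewrite /on_chain.
apply/mapP/idP => [[i]|].
  rewrite mem_iota add0n => /andP[_ i_n] ->.
  by have [ti|ti] := leqP i t; rewrite row_at //= pos_at //; lia.
case: eqP => v10 vt.
  exists (pos_of v); first by rewrite mem_iota; lia.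
  by rewrite vt; apply: L2P; rewrite ?row_at ?pos_at.
exists (pos_of v).+1; first by rewrite mem_iota; lia.
by rewrite ltnNge vt /=; apply: L2P; rewrite ?row_at ?pos_at //; lia.
Qed.

Lemma saturated_chain_at t : saturated (chain_at t).
Proof.
have lt := ltn_ord t; apply/(sortedP (L2_at 0 0)) => i; rewrite size_mkseq => i_n.
rewrite !nth_mkseq //; last by lia.
rewrite coveredE.
by case: (leqP i t) => it; case: (leqP i.+1 t) => it'; rewrite ?row_at ?pos_at //=; lia.
Qed.

Lemma size_chain_at t : size (chain_at t) = n.+2.
Proof. exact: size_mkseq. Qed.

Lemma saturated_rank u s : saturated (u :: s) ->
  map L2_rank (u :: s) = iota (L2_rank u) (size s).+1.
Proof.
rewrite /saturated /=; elim: s u => [//|v s IH] u /= /andP[uv vs].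
by have /= -> := IH v vs; rewrite (covered_rank uv).
Qed.

Lemma saturated_uniq s : saturated s -> uniq s.
Proof.
case: s => // u s /saturated_rank us; apply: (@map_uniq _ _ L2_rank).
by rewrite us iota_uniq.
Qed.

Lemma saturated_size s : saturated s -> (size s <= n.+2)%N.
Proof.
case: s => // u s /saturated_rank us.
have : (L2_rank u + size s)%N \in map L2_rank (u :: s) by rewrite us mem_iota; lia.
by case/mapP => v _; have := L2_bound v; rewrite /L2_rank /=; lia.
Qed.

(** Ranks go up by one along a saturated chain and range from 0 to n + 1. A chain missing the bottom
    or top rank can be extended there. *)
Lemma max_saturatedP s : max_saturated s <-> saturated s /\ size s = n.+2.
Proof.
split=> [[sat smax]|[sat sz]]; last first.
  split=> // s' sat' ss' v vs'.
  have [|_ ->] // := uniq_min_size (saturated_uniq sat) ss'.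
  by rewrite sz saturated_size.
split=> //; apply/eqP; rewrite eqn_leq saturated_size //=.
case: s sat smax => [|u s] sat smax.
  have /(_ (L2_at 0 0)) := smax [:: L2_at 0 0] isT ltac:(by []).
  by rewrite !inE eqxx => /(_ isT).
have us := saturated_rank sat.
have u0 : L2_rank u = 0%N.
  apply/eqP; rewrite -leqn0 leqNgt; apply/negP => u0.
  have [v vu] : exists v, covered v u.
    have [u1 u2] := L2_bound u; move: u0; rewrite /L2_rank => u0.
    (* The previous element of the row, or (0, 0) when u is (1, 0). *)
    exists (if pos_of u == 0%N then L2_at 0 0 else L2_at (row_of u) (pos_of u).-1).
    by case: eqP => ?; rewrite coveredE row_at ?pos_at //; lia.
  have : v \in u :: s.
    apply: (smax (v :: u :: s)); last by rewrite inE eqxx.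
      by rewrite /saturated /= vu.
    by move=> w ws; rewrite inE ws orbT.
  move=> /(map_f L2_rank); rewrite us mem_iota (covered_rank vu); lia.
rewrite ltnNge; apply/negP => szs; have {}szs : (size s <= n)%N by [].

have ls : L2_rank (last u s) = size s.
  have := congr1 (last 0%N) us; rewrite /= last_map u0 => ->.
  by rewrite (last_nth 0%N) -[RHS]add0n -(nth_iota 0 0 (ltnSn _)) size_iota.
have [v lv] : exists v, covered (last u s) v.
  have [l1 l2] := L2_bound (last u s); move: ls; rewrite /L2_rank => ls.
  (* The next element of the row, or (1, n) when the last element is (0, n); it cannot be (1, n),
     whose rank n + 1 exceeds [size s]. *)
  exists (if (pos_of (last u s) < n)%N then L2_at (row_of (last u s)) (pos_of (last u s)).+1
          else L2_at 1 n).
  by case: ltnP => ?; rewrite coveredE row_at ?pos_at //; lia.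
have : v \in u :: s.
  apply: (smax (rcons (u :: s) v)); last by rewrite mem_rcons inE eqxx.
    by rewrite /saturated /= rcons_path lv andbT.
  by move=> w ws; rewrite mem_rcons inE ws orbT.
move=> /(map_f L2_rank); rewrite us mem_iota u0 (covered_rank lv) ls; lia.
Qed.

(** Rows weakly increase along the chain, so the last index in the bottom row, together with the
    ranks, determines every element. *)
Lemma saturated_chain s : saturated s -> size s = n.+2 -> exists t, s = chain_at t.
Proof.
move=> sat sz; have := sat; move/(sortedP (L2_at 0 0)); rewrite sz => cov.
pose a i := nth (L2_at 0 0) s i.
have a_rank i : (i < n.+2)%N -> L2_rank (a i) = i.
  have ai j : (j < n.+2)%N -> L2_rank (a j) = (L2_rank (a 0%N) + j)%N.
    elim: j => [|j IH] j_n; first by rewrite addn0.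
    by rewrite (covered_rank (cov j j_n)) IH ?addnS // ltnW.
  move=> i_n; have := ai n.+1 (ltnSn _); have := L2_bound (a n.+1); rewrite (ai i i_n).
  by rewrite /L2_rank; lia.
have a_mono i j : (i <= j < n.+2)%N -> (row_of (a i) <= row_of (a j))%N.
  elim: j => [|j IH]; first by case: i.
  case: (ltngtP i j.+1) => [ij|//|-> //] /= j_n.
  apply: leq_trans (IH _) _; first by lia.
  by have := cov j j_n; rewrite coveredE -/(a j) -/(a j.+1); lia.
pose P i := (i < n.+2)%N && (row_of (a i) == 0%N).
have P0 : exists i, P i by exists 0%N; have := a_rank 0%N isT; rewrite /P /L2_rank; lia.
have Pn i : P i -> (i <= n.+1)%N by case/andP.
case: (ex_maxnP P0 Pn) => t0 /andP[t0n at0] t0max.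
have t0_n : (t0 < n.+1)%N.
  by have := a_rank t0 t0n; have := L2_bound (a t0); rewrite /L2_rank; lia.
exists (Ordinal t0_n); apply: (@eq_from_nth _ (L2_at 0 0)); first by rewrite size_mkseq.
move=> i; rewrite sz => i_n; rewrite nth_mkseq //= -/(a i).
have [a1 a2] := L2_bound (a i); have := a_rank i i_n; rewrite /L2_rank => ai.
case: leqP => it.
  have := a_mono i t0; rewrite it t0n (eqP at0) => /(_ isT) ?.
  by apply: L2P; rewrite ?row_at ?pos_at //; lia.
have : ~~ P i by apply/negP => /t0max; rewrite leqNgt it.
rewrite /P i_n /= => ai1.
by apply: L2P; rewrite ?row_at ?pos_at //; lia.
Qed.

(** Members of consecutive rank are neighbours, since ranks rise by exactly one along [s]. *)
Lemma mem_zip_saturated s u v : saturated s -> covered u v ->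
  ((u, v) \in zip s (behead s)) = (u \in s) && (v \in s).
Proof.
move=> sat /covered_rank uv_rank.
case: s sat => // a s; elim: s a => [|b s IH] a sat.
  by rewrite /= !inE; apply/esym/negP => /andP[/eqP e1 /eqP e2]; move: uv_rank; rewrite e1 e2; lia.
have [ab bs] : covered a b /\ saturated (b :: s) by move: sat => /andP.
have ab_rank := covered_rank ab; have bs_rank := saturated_rank bs.
rewrite [LHS]in_cons (IH b bs) xpair_eqE.
have above w : w \in b :: s -> (L2_rank a < L2_rank w)%N.
  by move=> /(map_f L2_rank); rewrite bs_rank mem_iota ab_rank; lia.
have above2 w : w \in s -> (L2_rank b < L2_rank w)%N.
  by move=> /(map_f L2_rank); case: bs_rank => ->; rewrite mem_iota; lia.
rewrite ![_ \in a :: _]in_cons; have [ua|ua] := eqVneq u a; last first.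
  have [va|//] := eqVneq v a; rewrite /= andbT.
  have [/above|//] := boolP (u \in b :: s); rewrite -va uv_rank; lia.
rewrite /= !in_cons; have [ub|ub] := eqVneq u b; first by move: ab_rank; rewrite -ua -ub; lia.
have [vb|vb] := eqVneq v b; first by rewrite orbT.
have [vs|vs] := boolP (v \in s).
  by have := above2 _ vs; rewrite ab_rank uv_rank ua; lia.
by rewrite !orbF andbF; apply/esym/negP => /eqP va; move: uv_rank; rewrite va ua; lia.
Qed.

Lemma chain_edgeE t (e : edge L) :
  chain_edge (chain_at t) e = on_chain t (val e).1 && on_chain t (val e).2.
Proof.
case: e => -[u v] /= uv; rewrite /chain_edge /= -!mem_chain_at.
exact: mem_zip_saturated (saturated_chain_at t) uv.
Qed.

End MaximalChains.

Local Open Scope ring_scope.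

(** * The two ideals *)

Section Combine.
Variables (k : fieldType) (N n d : nat) (m : 'I_n -> 'X_{1..N}).
Variable G : {mpoly k[N]} -> Prop.
Hypothesis GE : forall p, G p <-> exists i, p = 'X_[m i].

Lemma quot_ideal_depth (sigma : 'I_N -> 'I_N) (C : pred 'I_N) (w : 'X_{1..N}) :
    (forall i, sigma (sigma i) = sigma i) -> lcm_preserving m sigma ->
    (forall s, m s != 0%MM) ->
    (forall j, ~~ (m j <= w)%MM) ->
    (forall i, C i -> exists j, (m j <= w + U_(i))%MM) ->
    #|[pred i | sigma i != i]| = d -> #|[predC C]| = d ->
  is_depth (quot_ideal G) (@max_ideal k N) d.
Proof.
move=> sK slcm m0 wI wC sd Cd; split.
  by have [f [fs fm fr]] := regular_seq_exists GE sK slcm m0; exists f; rewrite fs sd.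
by move=> f fm fr; rewrite -Cd; apply: (regular_seq_size GE wI wC).
Qed.

End Combine.

Lemma mlcm_val N (a b : 'X_{1..N}) i : mlcm a b i = maxn (a i) (b i).
Proof. exact: mnmE. Qed.

(** * The path ideal *)

Section PathIdeal.
Variables (k : fieldType) (n : nat) (n_gt0 : (0 < n)%N).
Local Notation L := (L2 n.+1).
Local Notation N := (2 * n.+1)%N.
Variables (x : L -> 'I_N) (xi : 'I_N -> L) (xK : cancel x xi) (xiK : cancel xi x).

Definition path_mnm (t : 'I_n.+1) : 'X_{1..N} := [multinom (on_chain t (xi i) : nat) | i < N].

Lemma path_mnmE t v : path_mnm t (x v) = on_chain t v :> nat.
Proof. by rewrite mnmE xK. Qed.

Lemma path_genE (p : {mpoly k[N]}) :
  path_gen n.+2 x p <-> exists t, p = 'X_[path_mnm t].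
Proof.
have prodE t : \prod_(v <- chain_at t) 'X_(x v) = 'X_[path_mnm t] :> {mpoly k[N]}.
  rewrite mprodXE; congr 'X_[_]; apply/mnmP => i; rewrite mnmE mnm_sumE -mem_chain_at.
  rewrite -(count_uniq_mem _ (saturated_uniq (saturated_chain_at t))) -sum1_count [RHS]big_mkcond.
  by apply: eq_bigr => v _; rewrite mnm1E (can2_eq xK xiK) /=; case: eqP.
split=> [[s [sat sz ->]]|[t ->]].
  by have [t ->] := saturated_chain sat sz; exists t.
exists (chain_at t); rewrite prodE size_chain_at; split=> //.
exact: saturated_chain_at.
Qed.

Lemma mdeg_sum_x (mu : 'X_{1..N}) : mdeg mu = (\sum_v mu (x v))%N.
Proof. by rewrite mdegE (reindex x) //; exists xi => i _. Qed.

Lemma mdeg_path t : mdeg (path_mnm t) = n.+2.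
Proof.
rewrite mdeg_sum_x -(size_chain_at t).
rewrite -(card_uniqP (saturated_uniq (saturated_chain_at t))) -sum1_card [RHS]big_mkcond.
by apply: eq_bigr => v _; rewrite path_mnmE mem_chain_at; case: on_chain.
Qed.

Lemma path_nbr_lcm_E (j : 'I_n) v :
  nbr_lcm path_mnm j (x v) = (if row_of v == 0 then pos_of v <= j.+1 else j <= pos_of v)%N :> nat.
Proof.
rewrite /nbr_lcm mnmE !path_mnmE /on_chain /= /bump leq0n add1n.
by case: eqP => _; lia.
Qed.

(** Passing from chain j to chain j + 1 exchanges (1, j) for (0, j + 1), so their union has one
    element more than either. *)
Lemma mdeg_path_nbr_lcm (j : 'I_n) : mdeg (nbr_lcm path_mnm j) = n.+3.
Proof.
have jn := ltn_ord j.
rewrite mdeg_sum_x -(mdeg_path (widen_ord (leqnSn n) j)) mdeg_sum_x.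
rewrite (bigD1 (L2_at n 0 j.+1)) //= [in RHS](bigD1 (L2_at n 0 j.+1)) //=.
rewrite path_nbr_lcm_E path_mnmE /on_chain row_at // pos_at //= leqnn ltnn add1n add0n.
congr _.+1; apply: eq_bigr => v vj; rewrite path_nbr_lcm_E path_mnmE /on_chain /=.
case: eqP => // v0; congr nat_of_bool.
have : pos_of v != j.+1; last by lia.
by apply: contra_neq vj => vj; apply: L2P; rewrite ?row_at ?pos_at.
Qed.

(* Each row collapses to its first element; the quotients of generators s and t by      *)
(* their gcd lie in different rows.                                                        *)
Definition path_merge (i : 'I_N) : 'I_N := x (L2_at n (row_of (xi i)) 0).

(** The set C for the upper bound on depth: chain 0 contains (1, 0) but not (0, 1), and every other
    chain contains (0, 1) but not (1, 0). *)
Definition path_cover : pred 'I_N := pred2 (x (L2_at n 1 0)) (x (L2_at n 0 1)).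

Lemma path_pd_reg_depth :
  [/\ is_pd (quot_ideal (path_gen (k := k) n.+2 x)) 2,
      is_reg (quot_gr (G := path_gen (k := k) n.+2 x)) n.+1
    & is_depth (quot_ideal (path_gen n.+2 x)) (@max_ideal k N) (2 * n.+1 - 2)].
Proof.
have m_lcm (s j t : 'I_n.+1) :
    (s <= j <= t)%N -> (path_mnm j <= mlcm (path_mnm s) (path_mnm t))%MM.
  move=> sjt; apply/mnm_lepP => i; rewrite -[i]xiK mlcm_val !path_mnmE /on_chain.
  by case: eqP => _; lia.
have m0 s : path_mnm s != 0%MM.
  apply/eqP => /mnmP /(_ (x (L2_at n 0 0))).
  by rewrite path_mnmE mnm0E /on_chain row_at // pos_at.
have lcm_neq (j : 'I_n) (c : 'I_n.+1) : (c == j :> nat) || (c == j.+1 :> nat) ->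
    nbr_lcm path_mnm j != path_mnm c.
  move=> _; apply/eqP => /(congr1 mdeg).
  by rewrite mdeg_path mdeg_path_nbr_lcm => /eqP; rewrite eqn_leq ltnn.
split.
- exact: (nbr_pd path_genE m_lcm m0 lcm_neq).
- apply: (nbr_reg path_genE m_lcm m0 lcm_neq); [exact: mdeg_path | exact: mdeg_path_nbr_lcm].
have v10 : x (L2_at n 1 0) != x (L2_at n 0 1).
  rewrite (can_eq xK); apply/eqP => /(congr1 (@row_of n)).
  by rewrite !row_at.
have cover_chain j : on_chain j (L2_at n 1 0) || on_chain j (L2_at n 0 1).
  by rewrite /on_chain !row_at // !pos_at //=; lia.
apply: (@quot_ideal_depth _ _ _ _ _ _ path_genE path_merge path_cover
  [multinom (~~ path_cover i : nat) | i < N]) => //.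
- by move=> i; rewrite /path_merge xK row_at //; case: (L2_bound (xi i)).
- move=> s t a b; rewrite -[a]xiK -[b]xiK !path_mnmE /path_merge !xK (can_eq xK).
  have [[a1 _] [b1 _]] := (L2_bound (xi a), L2_bound (xi b)).
  move=> sa tb; apply/eqP => /(congr1 (@row_of n)); rewrite !row_at // => ab.
  by move: sa tb; rewrite /on_chain ab; case: eqP => _; lia.
- move=> j; apply/negP => /mnm_lepP le_j; have := cover_chain j.
  case/orP => cj.
    by have := le_j (x (L2_at n 1 0)); rewrite path_mnmE cj mnmE /path_cover /= eqxx.
  by have := le_j (x (L2_at n 0 1)); rewrite path_mnmE cj mnmE /path_cover /= eqxx orbT.
- have n1 : (1 < n.+1)%N by [].
  have coverE v : path_cover (x v) = (v == L2_at n 1 0) || (v == L2_at n 0 1).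
    by rewrite /path_cover /= !(can_eq xK).
  (* Multiplying w by the variable of (1, 0) makes it divisible by the monomial of chain 0, by that
     of (0, 1) by the monomial of chain 1. *)
  move=> i /orP[/eqP ->|/eqP ->].
    exists ord0; apply/mnm_lepP => l; rewrite -[l]xiK mnmDE mnm1E path_mnmE mnmE coverE.
    rewrite (can_eq xK) [L2_at _ _ _ == _]eq_sym; have [->|_] := eqVneq (xi l) (L2_at n 0 1).
      by rewrite /on_chain row_at // pos_at.
    by rewrite orbF; case: (_ == _); case: on_chain.
  exists (Ordinal n1); apply/mnm_lepP => l; rewrite -[l]xiK mnmDE mnm1E path_mnmE mnmE coverE.
  rewrite (can_eq xK) [L2_at _ _ _ == _]eq_sym; have [->|_] := eqVneq (xi l) (L2_at n 1 0).
    by rewrite /on_chain row_at // pos_at.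
  by case: (_ == _); case: on_chain.
- have v00 : x (L2_at n 0 0) != x (L2_at n 1 0).
    by rewrite (can_eq xK); apply/eqP => /(congr1 (@row_of n)); rewrite !row_at.
  have fixed2 : #|[predC [pred i | path_merge i != i]]| = 2.
    transitivity #|pred2 (x (L2_at n 0 0)) (x (L2_at n 1 0))|; last by rewrite card2 v00.
    apply: eq_card => i; rewrite -[i]xiK !inE negbK /path_merge !xK !(can_eq xK).
    have [v1 v2] := L2_bound (xi i).
    apply/eqP/orP => [<-|[]/eqP ->]; rewrite ?row_at ?pos_at //.
    by case: (row_of _) v1 => [|[|]] // _; rewrite eqxx; [left | right].
  apply: (@addIn 2); rewrite -{1}fixed2 cardC card_ord subnK //; lia.
have cover2 : #|path_cover| = 2 by rewrite card2 v10.
by apply: (@addIn 2); rewrite -{1}cover2 addnC cardC card_ord subnK //; lia.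
Qed.

End PathIdeal.

(** * The ideal of edge monomials of maximal chains *)

Section LDIdeal.
Variables (k : fieldType) (n : nat) (n_gt0 : (0 < n)%N).
Local Notation L := (L2 n.+1).
Local Notation N := (3 * n.+1 - 2)%N.
Variables (y : edge L -> 'I_N) (yi : 'I_N -> edge L) (yK : cancel y yi) (yiK : cancel yi y).
Implicit Types (e : edge L) (t : 'I_n.+1).

Definition src_row e := row_of (val e).1.
Definition tgt_row e := row_of (val e).2.
Definition src_pos e := pos_of (val e).1.
Definition tgt_pos e := pos_of (val e).2.

Lemma edge_data e : [/\ (src_row e < 2)%N, (tgt_row e < 2)%N, (src_pos e < n.+1)%N, (tgt_pos e < n.+1)%N
  & ((src_row e == tgt_row e) && (tgt_pos e == (src_pos e).+1)) ||
    [&& src_row e == 0, tgt_row e == 1 & src_pos e == tgt_pos e]%N].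
Proof.
have [a b] := L2_bound (val e).1; have [c d] := L2_bound (val e).2; split=> //.
by have := valP e; rewrite /= coveredE.
Qed.

Lemma edgeP e e' : src_row e = src_row e' -> tgt_row e = tgt_row e' ->
  src_pos e = src_pos e' -> tgt_pos e = tgt_pos e' -> e = e'.
Proof.
move=> h1 h2 h3 h4; apply: val_inj; rewrite [LHS]surjective_pairing [RHS]surjective_pairing.
by congr (_, _); apply: L2P.
Qed.

Definition vertical e : bool := src_row e != tgt_row e.

Lemma vert_covered (a : 'I_n.+1) : covered (L2_at n 0 a) (L2_at n 1 a).
Proof. by rewrite coveredE !row_at // !pos_at // !eqxx. Qed.

Definition vert (a : 'I_n.+1) : edge L := Sub (L2_at n 0 a, L2_at n 1 a) (vert_covered a).

Lemma vert_data a : [/\ src_row (vert a) = 0%N, tgt_row (vert a) = 1%N,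
  src_pos (vert a) = a & tgt_pos (vert a) = a].
Proof. by rewrite /src_row /tgt_row /src_pos /tgt_pos /= !row_at // !pos_at. Qed.

Lemma vertical_vert a : vertical (vert a).
Proof. by rewrite /vertical; case: (vert_data a) => -> ->. Qed.

Lemma verticalP e : vertical e -> exists a, e = vert a.
Proof.
rewrite /vertical => ve; have [h1 h2 h3 h4 h5] := edge_data e.
exists (Ordinal h3); have [v1 v2 v3 v4] := vert_data (Ordinal h3).
by apply: edgeP; rewrite ?v1 ?v2 ?v3 ?v4 //=; lia.
Qed.

Lemma vert_inj : injective vert.
Proof.
move=> a b /(congr1 src_pos); case: (vert_data a) => _ _ -> _; case: (vert_data b) => _ _ -> _.
exact: val_inj.
Qed.

Lemma card_vertical : #|[pred e | vertical e]| = n.+1.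
Proof.
rewrite -[RHS]card_ord -(card_image vert_inj predT); apply: eq_card => e; rewrite !inE.
apply/idP/imageP => [/verticalP [a ->]|[a _ ->]]; first by exists a.
exact: vertical_vert.
Qed.

Lemma card_horizontal : #|[pred e | ~~ vertical e]| = (2 * n.+1 - 2)%N.
Proof.
have := cardC [pred e | vertical e]; rewrite card_vertical card_edge_L2 => cC.
have -> : #|[pred e | ~~ vertical e]| = #|[predC [pred e | vertical e]]|.
  by apply: eq_card => e; rewrite !inE.
apply: (@addnI n.+1); rewrite cC; lia.
Qed.

Definition LD_chain t e : bool :=
  (if src_row e == 0%N then (src_pos e <= t)%N else (t <= src_pos e)%N) &&
  (if tgt_row e == 0%N then (tgt_pos e <= t)%N else (t <= tgt_pos e)%N).

Definition LD_mnm t : 'X_{1..N} := [multinom (LD_chain t (yi i) : nat) | i < N].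

Lemma LD_mnmE t e : LD_mnm t (y e) = LD_chain t e :> nat.
Proof. by rewrite mnmE yK. Qed.

Lemma LD_chain_vert t a : LD_chain t (vert a) = (t == a).
Proof.
by rewrite /LD_chain; case: (vert_data a) => -> -> -> ->; rewrite /= -eqn_leq eq_sym.
Qed.

Lemma LD_genE (p : {mpoly k[N]}) : LD_gen y p <-> exists t, p = 'X_[LD_mnm t].
Proof.
have prodE t : \prod_(e : edge L | chain_edge (chain_at t) e) 'X_(y e)
    = 'X_[LD_mnm t] :> {mpoly k[N]}.
  rewrite mprodXE; congr 'X_[_]; apply/mnmP => i; rewrite mnmE mnm_sumE big_mkcond.
  rewrite (bigD1 (yi i)) //= big1 ?addn0 => [|e ei].
    by rewrite chain_edgeE mnm1E yiK eqxx /LD_chain /on_chain; case: ifP.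
  by case: ifP => // _; rewrite mnm1E (can2_eq yK yiK) (negbTE ei).
split=> [[s [/max_saturatedP [sat sz] ->]]|[t ->]].
  by have [t ->] := saturated_chain sat sz; exists t.
exists (chain_at t); rewrite prodE; split=> //; apply/max_saturatedP.
by rewrite size_chain_at; split=> //; apply: saturated_chain_at.
Qed.

(** Each chain of A brings exactly one vertical edge, not shared with another chain; these account
    for #|A|, and the excess counts horizontal edges. *)
Lemma mdeg_LD_lcm (A : {set 'I_n.+1}) : mdeg (lcm_mnm LD_mnm A) =
  (\sum_(e | ~~ vertical e) \max_(t in A) LD_chain t e + #|A|)%N.
Proof.
rewrite mdegE (reindex y) /=; last by exists yi => i _.
rewrite (bigID vertical) /= addnC; congr (_ + _)%N.
  by apply: eq_bigr => e _; rewrite mnmE; apply: eq_bigr => t _; rewrite LD_mnmE.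
rewrite (reindex_onto vert (fun e => odflt ord0 [pick a | e == vert a])) => [|e ve]; last first.
  have [a ->] := verticalP ve; case: pickP => [b /eqP->//|/(_ a)].
  by rewrite eqxx.
rewrite -sum1_card [RHS]big_mkcond; apply: eq_big => [a|a _].
  rewrite vertical_vert; case: pickP => [b|/(_ a)]; last by rewrite eqxx.
  by rewrite (inj_eq vert_inj) => /eqP->; rewrite /= eqxx.
rewrite mnmE; case: ifP => aA; last first.
  rewrite big1 // => t tA; rewrite LD_mnmE LD_chain_vert.
  by case: eqP => // ta; rewrite -ta tA in aA.
apply/eqP; rewrite eqn_leq; apply/andP; split.
  by apply/bigmax_leqP => t _; rewrite LD_mnmE leq_b1.
by rewrite (bigD1 a) //= LD_mnmE LD_chain_vert eqxx leq_maxl.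
Qed.

Lemma card_yi (P : pred (edge L)) : #|[pred i | P (yi i)]| = #|[pred e | P e]|.
Proof.
rewrite -!sum1_card (reindex y) /=; last by exists yi => i _.
by apply: eq_bigl => e; rewrite !inE yK.
Qed.

(* Bottom edges are identified with the last vertical edge and top edges with the first    *)
(* one, which keeps the quotients of two generators by their gcd coprime.                  *)
Definition LD_color e : 'I_n.+1 :=
  inord (if vertical e then src_pos e else if src_row e == 0%N then n else 0%N).

Definition LD_merge (i : 'I_N) : 'I_N := y (vert (LD_color (yi i))).

Lemma LD_pd_reg_depth :
  [/\ is_pd (quot_ideal (LD_gen (k := k) y)) n.+1,
      is_reg (quot_gr (G := LD_gen (k := k) y)) (2 * n.+1 - 2)
    & is_depth (quot_ideal (LD_gen y)) (@max_ideal k N) (2 * n.+1 - 2)].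
Proof.
have lcm_min (j : 'I_n.+1) (B : {set 'I_n.+1}) :
    j \notin B -> lcm_mnm LD_mnm (j |: B) != lcm_mnm LD_mnm B.
  move=> jB; apply/eqP => /mnmP /(_ (y (vert j))); rewrite !mnmE [RHS]big1 => [|t tB].
    by rewrite big_setU1 //= LD_mnmE LD_chain_vert eqxx; lia.
  by rewrite LD_mnmE LD_chain_vert; case: eqP => // e; rewrite -e tB in jB.
have colorE e : LD_color e = (if vertical e then src_pos e
    else if src_row e == 0%N then n else 0)%N :> nat.
  by rewrite inordK //; have [_ _ ? _ _] := edge_data e; case: ifP => // _; case: ifP.
have color_vert a : LD_color (vert a) = a.
  by apply: val_inj; rewrite /= colorE vertical_vert; case: (vert_data a).
split.
- exact: (taylor_pd LD_genE lcm_min).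
- apply: (taylor_reg LD_genE lcm_min).
    move=> A; rewrite mdeg_LD_lcm addnC leq_add2l -card_horizontal -sum1_card.
    by apply: leq_sum => e _; apply/bigmax_leqP => t _; apply: leq_b1.
  (* Chain 0 runs through all top edges and chain n through all bottom ones. *)
  exists [set ord0; ord_max]; rewrite mdeg_LD_lcm addnC; congr (_ + _)%N.
  rewrite -card_horizontal -sum1_card; apply: eq_bigr => e he.
  have o0m : (ord0 : 'I_n.+1) \notin [set ord_max] by rewrite inE -val_eqE /= eq_sym -lt0n.
  rewrite big_setU1 //= big_set1 /LD_chain /=.
  have [h1 h2 h3 h4 h5] := edge_data e; move: he; rewrite negbK => /eqP <-.
  by case: eqP => _; lia.
(* Here C consists of the vertical edges and w is the product of the horizontal ones; each chain
   needs exactly one edge of C. *)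
apply: (@quot_ideal_depth _ _ _ _ _ _ LD_genE LD_merge [pred i | vertical (yi i)]
  [multinom (~~ vertical (yi i) : nat) | i < N]).
- by move=> i; rewrite /LD_merge yK color_vert.
(* For s < t, edges of chain s off chain t have colour s or 0 and those of chain t off chain s have
   colour t or n; since n > 0 these sets of colours are disjoint. *)
- move=> s t a b; rewrite -[a]yiK -[b]yiK !LD_mnmE /LD_merge !yK (can_eq yK) (inj_eq vert_inj).
  rewrite -val_eqE /= !colorE /vertical /LD_chain; move: (yi a) (yi b) => {a b} a b.
  have [a1 a2 a3 a4 a5] := edge_data a; have [b1 b2 b3 b4 b5] := edge_data b.
  have := ltn_ord s; have := ltn_ord t.
  move: (src_row a) (tgt_row a) (src_pos a) (tgt_pos a) a1 a2 a3 a4 a5 => p1 p2 p3 p4.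
  move: (src_row b) (tgt_row b) (src_pos b) (tgt_pos b) b1 b2 b3 b4 b5 => q1 q2 q3 q4.
  case: p1 => [|[|p1]] //; case: p2 => [|[|p2]] //=; case: q1 => [|[|q1]] //;
    case: q2 => [|[|q2]] //=; lia.
- move=> s; apply/eqP => /mnmP /(_ (y (vert s))).
  by rewrite LD_mnmE LD_chain_vert eqxx mnm0E.
- move=> j; apply/negP => /mnm_lepP /(_ (y (vert j))).
  by rewrite LD_mnmE LD_chain_vert eqxx mnmE yK vertical_vert.
- move=> i /verticalP [a ai]; exists a; apply/mnm_lepP => l.
  rewrite -[l]yiK -[i]yiK ai mnmDE mnm1E LD_mnmE mnmE yK (can_eq yK).
  have [/verticalP [b ->]|_] := boolP (vertical (yi l)); last by case: LD_chain.
  by rewrite LD_chain_vert (inj_eq vert_inj).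
- rewrite -card_horizontal -(card_yi (fun e => ~~ vertical e)); apply: eq_card => i; rewrite !inE.
  rewrite -[i]yiK /LD_merge !yK (can_eq yK); congr (~~ _).
  by apply/eqP/idP => [<-|/verticalP [a ->]]; rewrite ?vertical_vert // color_vert.
rewrite -card_horizontal -(card_yi (fun e => ~~ vertical e)).
by apply: eq_card => i; rewrite !inE.
Qed.

End LDIdeal.

Local Close Scope ring_scope.

Theorem corollary5p16 (k : fieldType) (n : nat) (hn : (2 <= n)%N)
  (x : L2 n -> 'I_(2 * n)) (hx : bijective x)
  (y : edge (L2 n) -> 'I_(3 * n - 2)) (hy : bijective y) :
  let Sn := {mpoly k[3 * n - 2]} in
  let Tn := {mpoly k[2 * n]} in
  let LDmons : Sn -> Prop := LD_gen y in
  let pathmons : Tn -> Prop := path_gen n.+1 x in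
  (is_pd (quot_ideal LDmons) n /\ is_pd (quot_ideal pathmons) 2) /\
  (is_reg (quot_gr (G := LDmons)) (2 * n - 2) /\
   is_reg (quot_gr (G := pathmons)) n) /\
  (is_depth (quot_ideal LDmons) (@max_ideal k (3 * n - 2)) (2 * n - 2) /\
   is_depth (quot_ideal pathmons) (@max_ideal k (2 * n)) (2 * n - 2)).
Proof.
move=> Sn Tn LDmons pathmons.
case: n hn x hx y hy @Sn @Tn @LDmons @pathmons => [//|n] hn x [xi xK xiK] y [yi yK yiK] /=.
have [pdL regL depthL] := LD_pd_reg_depth k (hn : 0 < n) yK yiK.
by have [pdT regT depthT] := path_pd_reg_depth k (hn : 0 < n) xK xiK.
Qed.
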